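(* The natural inclusions $C\cap R\to OH\to C+R$ are completely contractive, where $C,R$ and $OH=OH(\mathbb N)$ are all identified with $\ell_2$ as vector spaces.
   Context: All spaces are complex. An operator space is a Banach space $E$ given with an isometric embedding as a closed subspace of some $B(H)$, $H$ a Hilbert space; $M_n(E)$ is normed as a subspace of $M_n(B(H))=B(H\oplus\cdots\oplus H)$. For linear $u:E\to F$, $\|u\|_{cb}=\sup_n\|(a_{ij})\mapsto(u(a_{ij}))\|_{M_n(E)\to M_n(F)}$; $u$ is completely contractive if $\|u\|_{cb}\le1$; $cb(E,F)$ is the space of maps with $\|u\|_{cb}<\infty$; $u$ is a complete isometry if all these maps $M_n(E)\to M_n(F)$ are isometric. The dual $E^*$ is an operator space with $M_n(E^* )=cb(E,M_n)$; a quotient has $M_n(E/F)=M_n(E)/M_n(F)$. The complex conjugate $\overline{E}$ is the same Banach space with scalar multiplication $\lambda\cdot x=\overline{\lambda}x$ and operator space structure induced by $\overline{E}\subset\overline{B(H)}=B(\overline{H})$. $C=B(\mathbb C,\ell_2)$ and $R=B(\ell_2,\mathbb C)$ are identified linearly with $\ell_2$ via the canonical bases. $C\cap R$ is the subspace $\{(x,x)\}$ of $C\oplus_\infty R$, where $M_n(E_0\oplus_\infty E_1)=M_n(E_0)\oplus_\infty M_n(E_1)$ (max norm). $C+R$ is the quotient $(C\oplus_1R)/\{(x,-x)\}$, where $E_0\oplus_1E_1$ has norm $\|x\|+\|y\|$ and $M_n(E_0\oplus_1E_1)$ carries the norm induced by $cb(E_0^*\oplus_\infty E_1^*,M_n)$.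 $OH$ is the operator space, unique up to complete isometry, which is isometric to $\ell_2$ as a Banach space and for which the natural linear identification $x\mapsto\langle\cdot,x\rangle$ from $OH$ to its antidual $\overline{OH^*}$ is a complete isometry; it is identified with $\ell_2$ via an orthonormal basis. *)

(* Defs.v *)
From HB Require Import structures.
From mathcomp Require Import all_boot all_order all_algebra.
From mathcomp Require Import generic_quotient ring_quotient.
From mathcomp Require Import all_classical all_reals all_analysis.
From mathcomp.real_closed Require Import complex.
From mathcomp Require Import zify ring lra.
Set Implicit Arguments. Unset Strict Implicit. Unset Printing Implicit Defensive.
Import Order.TTheory GRing.Theory Num.Theory.
Import numFieldNormedType.Exports.
Local Open Scope classical_set_scope.
Local Open Scope ring_scope.

Section InnerProduct.
Variables (R : realType) (V : lmodType R[i]) (d : V -> V -> R[i]).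
Hypothesis dl : forall z (a : R[i]) x y, d (a *: x + y) z = a * d x z + d y z.
Hypothesis dC : forall x y, d x y = (d y x)^*.
Hypothesis dge0 : forall x, 0 <= d x x.
Hypothesis deq0 : forall x, d x x = 0 -> x = 0.

Definition ipnorm (x : V) : R[i] := sqrtC (d x x).

Local Lemma dD x y z : d (x + y) z = d x z + d y z.
Proof. by have := dl z 1 x y; rewrite scale1r mul1r. Qed.
Local Lemma d0l z : d 0 z = 0.
Proof. by have /eqP := dD 0 0 z; rewrite addr0 -subr_eq0 opprD addrA subrr sub0r oppr_eq0 => /eqP. Qed.
Local Lemma dZ a x z : d (a *: x) z = a * d x z.
Proof. by have := dl z a x 0; rewrite addr0 d0l addr0. Qed.
Local Lemma dDr x y z : d x (y + z) = d x y + d x z.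
Proof. by rewrite dC dD rmorphD /= -!dC. Qed.
Local Lemma dZr a x y : d x (a *: y) = a^* * d x y.
Proof. by rewrite dC dZ rmorphM /= -dC. Qed.
Local Lemma dNl x y : d (- x) y = - d x y.
Proof. by rewrite -scaleN1r dZ mulN1r. Qed.
Local Lemma dNr x y : d x (- y) = - d x y.
Proof. by rewrite dC dNl rmorphN /= -dC. Qed.

Lemma ip_CS x y : `|d x y| ^+ 2 <= d x x * d y y.
Proof.
have [y0|y0] := eqVneq (d y y) 0.
  by rewrite (deq0 y0) d0l mulr0 dC d0l rmorph0 normr0 expr0n.
have yp : 0 < d y y by rewrite lt_def y0 dge0.
have yr : (d y y)^* = d y y by rewrite -dC.
have := dge0 (d y y *: x - d x y *: y).
rewrite !(dD, dDr, dNl, dNr, dZ, dZr) yr.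
have -> : d y y * (d y y * d x x) + - (d y y * ((d x y)^* * d x y))
   + (- (d x y * (d y y * d y x)) - - (d x y * ((d x y)^* * d y y)))
   = d y y * (d x x * d y y - `|d x y| ^+ 2).
  by rewrite normCK [d y x]dC; ring.
by rewrite pmulr_rge0 // subr_ge0.
Qed.

Lemma ipnormD x y : ipnorm (x + y) <= ipnorm x + ipnorm y.
Proof.
have n0 z : 0 <= ipnorm z by rewrite sqrtC_ge0.
have CS : `|d x y| <= ipnorm x * ipnorm y.
  rewrite -(ler_sqr (normr_ge0 _)) ?nnegrE ?mulr_ge0 //.
  by rewrite exprMn !sqrtCK ip_CS.
rewrite -ler_sqr ?nnegrE ?addr_ge0 // sqrrD !sqrtCK dD !dDr.
rewrite addrA -!(addrA (d x x)) lerD2l -addrA addrA lerD2r.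
rewrite [d y x]dC -mulr_natr.
have -> : d x y + (d x y)^* = 'Re (d x y) * 2.
  by rewrite ReE mulfVK // pnatr_eq0.
rewrite ler_pM2r ?ltr0n //; apply: le_trans CS.
apply: le_trans (real_ler_norm (Creal_Re _)) _.
by rewrite leif_normC_Re_Creal.
Qed.

Lemma ipnormZ a x : ipnorm (a *: x) = `|a| * ipnorm x.
Proof.
apply/eqP; rewrite -(eqrXn2 (n := 2)) ?mulr_ge0 ?sqrtC_ge0 //.
by rewrite exprMn !sqrtCK dZ dZr mulrA normCK.
Qed.

Lemma ipnorm0_eq0 x : ipnorm x = 0 -> x = 0.
Proof. by move/eqP; rewrite sqrtC_eq0 => /eqP /deq0. Qed.

End InnerProduct.

Section CauchyFilters.

Lemma cauchy_small (K : numFieldType) (V : normedModType K) (F : set_system V) :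
  ProperFilter F -> cauchy F -> forall e : K, 0 < e ->
  exists2 A, F A & forall x y, A x -> A y -> `|x - y| < e.
Proof.
move=> FF /cauchyP Fc e e0.
have e2 : 0 < e / 2 by rewrite divr_gt0.
have [z Fz] := Fc _ e2; exists (ball z (e / 2)) => // x y.
rewrite -!ball_normE /ball_ /= => zx zy; rewrite -(subrKA z) (splitr e).
by rewrite (le_lt_trans (ler_normD _ _)) // ltrD // distrC.
Qed.

Lemma cauchy_image (K L : numFieldType) (V : normedModType K)
    (W : normedModType L) (f : V -> W) (F : set_system V) :
  (forall e : L, 0 < e -> exists2 d : K, 0 < d &
     forall x y, `|x - y| < d -> `|f x - f y| < e) ->
  ProperFilter F -> cauchy F -> cauchy (f @ F).
Proof.
move=> fu FF Fc; apply/cauchyP => e /fu[d d0 fd].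
have [A FA Ad] := cauchy_small FF Fc d0.
have [x Ax] := filter_ex FA; exists (f x).
apply: (@filterS _ F _ A) FA => y Ay /=; rewrite -ball_normE /ball_ /=.
exact: fd (Ad _ _ Ax Ay).
Qed.

End CauchyFilters.

Section ComplexComplete.
Variable R : realType.
Local Notation reC := (@complex.Re R).
Local Notation imC := (@complex.Im R).
Local Open Scope complex_scope.

Lemma complex_gt0 (e : R[i]) : 0 < e -> exists2 r : R, 0 < r & e = r%:C.
Proof.
move=> e0; have er : e \is Num.real by rewrite ger0_real // ltW.
by exists (reC e); rewrite ?RRe_real // -ltcR RRe_real.
Qed.

Lemma normc_le_ReIm (z : R[i]) :
  `|z| <= (`|reC z| + `|imC z|)%:C.
Proof.
rewrite normc_def lecR -ler_sqr ?nnegrE ?sqrtr_ge0 ?addr_ge0 //.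
rewrite sqr_sqrtr ?addr_ge0 ?sqr_ge0 // sqrrD !real_normK ?num_real //.
by rewrite lerD2r lerDl mulrn_wge0 // mulr_ge0.
Qed.

Lemma normc_ge_Im (z : R[i]) : `|imC z|%:C <= `|z|.
Proof.
rewrite normc_def lecR -ler_sqr ?nnegrE ?sqrtr_ge0 //.
by rewrite sqr_sqrtr ?addr_ge0 ?sqr_ge0 // real_normK ?num_real // lerDr sqr_ge0.
Qed.

Lemma complex_complete (F : set_system R[i]^o) :
  ProperFilter F -> cauchy F -> cvg F.
Proof.
move=> FF Fc.
have Rec : cvg (reC @ F).
  apply: cauchy_cvg; apply: (@cauchy_image _ R R[i]^o R^o _ F _ FF Fc) => e e0.
  exists e%:C; first by rewrite ltcR.
  move=> x y xy; rewrite -ltcR; apply: le_lt_trans xy.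
  by have := normc_ge_Re (x - y); case: x y => [? ?] [? ?].
have Imc : cvg (imC @ F).
  apply: cauchy_cvg; apply: (@cauchy_image _ R R[i]^o R^o _ F _ FF Fc) => e e0.
  exists e%:C; first by rewrite ltcR.
  move=> x y xy; rewrite -ltcR; apply: le_lt_trans xy.
  by have := normc_ge_Im (x - y); case: x y => [? ?] [? ?].
apply/cvg_ex; exists (lim (reC @ F) +i* lim (imC @ F)).
apply/cvgrPdist_le => e /complex_gt0[r r0 ->].
have r2 : 0 < r / 2 by rewrite divr_gt0.
have /cvgrPdist_le/(_ _ r2) rF := Rec; have /cvgrPdist_le/(_ _ r2) iF := Imc.
near=> z; apply: le_trans (normc_le_ReIm _) _; rewrite lecR (splitr r).
have rz : `|lim (reC @ F) - reC z| <= r / 2 by near: z.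
have iz : `|lim (imC @ F) - imC z| <= r / 2 by near: z.
have reB a b w : reC (a +i* b - w) = a - reC w by case: w.
have imB a b w : imC (a +i* b - w) = b - imC w by case: w.
by rewrite reB imB lerD.
Unshelve. all: by end_near. Qed.

End ComplexComplete.

(* The complex field as a normed space over itself.  The alias is needed because
   [R[i]^o] cannot carry a second completeness instance. *)
Definition cplx (R : realType) : Type := R[i]^o.

HB.instance Definition _ (R : realType) := NormedModule.copy (cplx R) R[i]^o.
HB.instance Definition _ (R : realType) :=
  Uniform_isComplete.Build (cplx R) (@complex_complete R).

(* Inner products are linear in the first variable. *)
HB.mixin Record isHilbert (R : realType) H & CompleteNormedModule R[i] H := {
  dotp : H -> H -> R[i] ;
  dotp_linear : forall y a u v, dotp (a *: u + v) y = a * dotp u y + dotp v y ;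
  dotp_conj : forall x y, dotp x y = (dotp y x)^* ;
  dotp_norm : forall x, dotp x x = `|x| ^+ 2
}.

#[short(type="hilbertType")]
HB.structure Definition Hilbert (R : realType) :=
  {H of CompleteNormedModule R[i] H & isHilbert R H}.

Section CplxHilbert.
Variable R : realType.
Definition cplx_dot (x y : cplx R) : R[i] := (x : R[i]) * (y : R[i])^*.
Lemma cplx_dot_linear y a u v :
  cplx_dot (a *: u + v) y = a * cplx_dot u y + cplx_dot v y.
Proof. by rewrite /cplx_dot mulrDl mulrA. Qed.
Lemma cplx_dot_conj x y : cplx_dot x y = (cplx_dot y x)^*.
Proof. by rewrite /cplx_dot rmorphM /= conjCK mulrC. Qed.
Lemma cplx_dot_norm x : cplx_dot x x = `|x| ^+ 2.
Proof. by rewrite [RHS](@normCK _ (x : R[i])). Qed.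
HB.instance Definition _ := isHilbert.Build R (cplx R)
  cplx_dot_linear cplx_dot_conj cplx_dot_norm.
End CplxHilbert.

Section HilbertSum.
Variables (R : realType) (n : nat) (H : hilbertType R).

(* The Hilbert space direct sum of n copies of H. *)
Definition hsum : Type := {ffun 'I_n -> H}.
HB.instance Definition _ := GRing.Lmodule.copy hsum {ffun 'I_n -> H}.

Definition hsum_dot (u v : hsum) : R[i] := \sum_i dotp (u i) (v i).

Lemma hsum_dot_linear y a u v :
  hsum_dot (a *: u + v) y = a * hsum_dot u y + hsum_dot v y.
Proof.
rewrite /hsum_dot mulr_sumr -big_split /=; apply: eq_bigr => i _.
by rewrite !ffunE dotp_linear.
Qed.

Lemma hsum_dot_conj u v : hsum_dot u v = (hsum_dot v u)^*.
Proof. by rewrite /hsum_dot rmorph_sum; apply: eq_bigr => i _; rewrite dotp_conj. Qed.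

Lemma hsum_dot_ge0 u : 0 <= hsum_dot u u.
Proof. by apply: sumr_ge0 => i _; rewrite dotp_norm exprn_ge0. Qed.

Lemma hsum_dot_eq0 u : hsum_dot u u = 0 -> u = 0.
Proof.
move=> /eqP; rewrite psumr_eq0 => [/allP u0|i _]; last by rewrite dotp_norm exprn_ge0.
apply/ffunP => i; rewrite ffunE; apply/eqP.
have := u0 i (mem_index_enum _).
by rewrite dotp_norm expf_eq0 /= normr_eq0.
Qed.

HB.instance Definition _ := Lmodule_isNormed.Build R[i] hsum
  (ipnormD hsum_dot_linear hsum_dot_conj hsum_dot_ge0 hsum_dot_eq0)
  (ipnormZ hsum_dot_linear hsum_dot_conj hsum_dot_ge0)
  (ipnorm0_eq0 hsum_dot_eq0).

Lemma hsum_dot_norm (u : hsum) : hsum_dot u u = `|u| ^+ 2.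
Proof. by rewrite sqrtCK. Qed.

Lemma hsum_normE (u : hsum) : `|u| ^+ 2 = \sum_i `|u i| ^+ 2.
Proof. by rewrite -hsum_dot_norm; apply: eq_bigr => i _; rewrite dotp_norm. Qed.

Lemma hsum_coord_le (u : hsum) i : `|u i| <= `|u|.
Proof.
rewrite -ler_sqr ?nnegrE // hsum_normE (bigD1 i) //= lerDl.
by apply: sumr_ge0 => j _; rewrite exprn_ge0.
Qed.

Lemma hsum_small (u : hsum) (e : R[i]) : 0 <= e ->
  (forall i, `|u i| <= e / n.+1%:R) -> `|u| <= e.
Proof.
move=> e0 ue; rewrite -ler_sqr ?nnegrE // hsum_normE.
apply: (@le_trans _ _ (\sum_(i < n) (e / n.+1%:R) ^+ 2)).
  by apply: ler_sum => i _; rewrite ler_sqr ?nnegrE // divr_ge0 // ler0n.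
rewrite sumr_const card_ord -[X in X <= _]mulr_natl expr_div_n mulrCA.
rewrite ler_piMr ?exprn_ge0 //.
by rewrite ler_pdivrMr ?exprn_gt0 ?ltr0n // mul1r -natrX ler_nat; nia.
Qed.

Lemma hsum_complete (F : set_system hsum) : ProperFilter F -> cauchy F -> cvg F.
Proof.
move=> FF Fc.
have Fi i : cvg ((fun u : hsum => u i) @ F).
  apply: cauchy_cvg; apply: (@cauchy_image _ _ hsum H _ F _ FF Fc) => e e0.
  exists e => // u v; apply: le_lt_trans.
  by have := hsum_coord_le (u - v) i; rewrite !ffunE.
pose l : hsum := [ffun i => lim ((fun u : hsum => u i) @ F)].
apply/cvg_ex; exists l; apply/cvgrPdist_le => e e0.
have e1 : 0 < e / n.+1%:R by rewrite divr_gt0 ?ltr0n.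
have : F [set u : hsum | forall i, `|l i - u i| <= e / n.+1%:R].
  apply: filter_forall => i; rewrite ffunE.
  by have /cvgrPdist_le := Fi i; exact.
apply: filterS => u lu; apply: hsum_small (ltW e0) _ => i.
by have := lu i; rewrite !ffunE.
Qed.

HB.instance Definition _ := Uniform_isComplete.Build hsum hsum_complete.
HB.instance Definition _ := isHilbert.Build R hsum
  hsum_dot_linear hsum_dot_conj hsum_dot_norm.
End HilbertSum.

Section RealNorm.
Variable R : realType.
Local Open Scope complex_scope.
Implicit Type V : normedModType R[i].

(* The norm of a normed module over [R[i]] is [R[i]]-valued; this is the same
   number in [R]. *)
Definition rnorm V (x : V) : R := complex.Re `|x|.

Lemma rnormE V (x : V) : (rnorm x)%:C = `|x|.
Proof. by rewrite RRe_real // normr_real. Qed.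

Lemma rnorm_ge0 V (x : V) : 0 <= rnorm x.
Proof. by rewrite -ler0c rnormE. Qed.

Lemma rnormD V (x y : V) : rnorm (x + y) <= rnorm x + rnorm y.
Proof. by rewrite -lecR rmorphD /= !rnormE ler_normD. Qed.

Lemma rnormZ V (a : cplx R) (x : V) : rnorm ((a : R[i]) *: x) = rnorm a * rnorm x.
Proof.
suff : (rnorm ((a : R[i]) *: x))%:C = (rnorm a * rnorm x)%:C by case.
by rewrite rmorphM /= !rnormE normrZ.
Qed.

Lemma rnormX_complex V (x : V) k : (rnorm x ^+ k)%:C = `|x| ^+ k.
Proof. by rewrite rmorphXn /= rnormE. Qed.

Lemma cvg_complex (u : nat -> R) (l : R) : u @ \oo --> l ->
  (fun n => (u n)%:C : cplx R) @ \oo --> (l%:C : cplx R).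
Proof.
move=> /cvgrPdist_le ul; apply/cvgrPdist_le => e /complex_gt0[r r0 ->].
have := ul _ r0; apply: filterS => n; rewrite -lecR; congr (_ <= _).
have -> : (l%:C : cplx R) - (u n)%:C = (l - u n)%:C by rewrite rmorphB.
by rewrite [RHS]normc_def /= expr0n addr0 sqrtr_sqr.
Qed.

Lemma cvg_conj (u : nat -> cplx R) (l : cplx R) : u @ \oo --> l ->
  (fun n => (u n : R[i])^* : cplx R) @ \oo --> ((l : R[i])^* : cplx R).
Proof.
move=> /cvgrPdist_le ul; apply/cvgrPdist_le => e /ul; apply: filterS => n.
by rewrite -[X in X <= _]norm_conjC rmorphB /=.
Qed.

Lemma abs_cvg_series (V : completeNormedModType R[i]) (u : nat -> V) :
  cvgn (series (fun k => rnorm (u k))) -> cvgn (series u).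
Proof.
move=> /cvg_cauchy/cauchy_seriesP uc.
apply: cauchy_cvg; apply/cauchy_seriesP => e /complex_gt0[r r0 ->].
have := uc _ r0; apply: filterS => -[m n] /=; rewrite -ltcR; apply: le_lt_trans.
rewrite ger0_norm ?sumr_ge0 // => [|i _]; last exact: rnorm_ge0.
rewrite rmorph_sum /=; apply: le_trans (ler_norm_sum _ _ _) _.
by apply: ler_sum => i _; rewrite rnormE.
Qed.

End RealNorm.

Section Ell2.
Variable R : realType.
Local Open Scope complex_scope.
Implicit Types x y : nat -> cplx R.

Definition square_summable x : Prop :=
  cvgn (series (fun k => rnorm (x k) ^+ 2)).

Lemma square_summableP x : square_summable x <->
  exists M : R, forall n, \sum_(k < n) rnorm (x k) ^+ 2 <= M.
Proof.
split=> [/cvg_seq_bounded/bounded_fun_has_ubound[M xM]|[M xM]].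
  by exists M => n; rewrite -(big_mkord xpredT (fun k => rnorm (x k) ^+ 2)); apply: xM; exists n.
apply: nondecreasing_is_cvgn.
  by apply: nondecreasing_series => k _ _; exact: sqr_ge0.
by exists M => _ [n _ <-]; rewrite /series /= big_mkord.
Qed.

Definition square_summable_pred : {pred nat -> cplx R} :=
  fun x => `[< square_summable x >].

Lemma square_summable_submod : submod_closed square_summable_pred.
Proof.
split=> [|a x y /asboolP/square_summableP[M xM] /asboolP/square_summableP[N yN]].
  apply/asboolP/square_summableP; exists 0 => n; rewrite big1 // => i _.
  by rewrite /rnorm normr0 expr0n.
apply/asboolP/square_summableP.
exists (2 * rnorm (a : cplx R) ^+ 2 * M + 2 * N) => n.
apply: (@le_trans _ _ (\sum_(k < n) (2 * rnorm (a : cplx R) ^+ 2 * rnorm (x k) ^+ 2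
   + 2 * rnorm (y k) ^+ 2))); last first.
  rewrite big_split /= -!mulr_sumr; apply: lerD; apply: ler_wpM2l.
  - by rewrite mulr_ge0 // sqr_ge0.
  - exact: xM.
  - by [].
  - exact: yN.
apply: ler_sum => k _.
have h := rnormD (a *: x k) (y k); rewrite (rnormZ (a : cplx R)) in h.
have h0 := rnorm_ge0 (a *: x k + y k).
have -> : (a *: x + y) k = a *: x k + y k by [].
have h1 : rnorm (a *: x k + y k) ^+ 2 <= (rnorm (a : cplx R) * rnorm (x k) + rnorm (y k)) ^+ 2.
  by rewrite ler_sqr ?nnegrE // (le_trans h0 h).
apply: le_trans h1 _; rewrite -subr_ge0.
set p := rnorm _; set q := rnorm _; set r := rnorm _.
have -> : 2 * p ^+ 2 * q ^+ 2 + 2 * r ^+ 2 - (p * q + r) ^+ 2 = (p * q - r) ^+ 2.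
  by ring.
exact: sqr_ge0.
Qed.

HB.instance Definition _ := GRing.isSubmodClosed.Build R[i] (nat -> cplx R)
  square_summable_pred square_summable_submod.

Record ell2 := Ell2 { ell2_seq :> nat -> cplx R ; _ : ell2_seq \in square_summable_pred }.

HB.instance Definition _ := [isSub for ell2_seq].
HB.instance Definition _ := [Choice of ell2 by <:].
HB.instance Definition _ := [SubChoice_isSubLmodule of ell2 by <:].

End Ell2.

Section Ell2Dot.
Variable R : realType.
Local Open Scope complex_scope.
Local Notation ell2 := (ell2 R).

Lemma ell2_summable (x : ell2) : cvgn (series (fun k => rnorm (x k) ^+ 2)).
Proof. by case: x => x /= /asboolP. Qed.

Local Arguments ell2_summable : clear implicits.

Lemma rnorm_dotp (a b : cplx R) : rnorm (dotp a b : cplx R) = rnorm a * rnorm b.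
Proof.
suff : (rnorm (dotp a b : cplx R))%:C = (rnorm a * rnorm b)%:C by case.
by rewrite rmorphM /= !rnormE [LHS]normrM norm_conjC.
Qed.

Lemma is_cvg_ell2_dot (x y : ell2) :
  cvgn (series (fun k => dotp (x k) (y k) : cplx R)).
Proof.
apply: abs_cvg_series.
have xy := is_cvg_seriesD (ell2_summable x) (ell2_summable y).
apply: series_le_cvg xy => k; first exact: rnorm_ge0.
  by rewrite addr_ge0 // sqr_ge0.
rewrite rnorm_dotp; set p := rnorm _; set q := rnorm _.
rewrite -subr_ge0.
have -> : (p ^+ 2 + q ^+ 2) - p * q = ((p - q) ^+ 2 + (p ^+ 2 + q ^+ 2)) / 2 by field.
by rewrite divr_ge0 // !addr_ge0 // sqr_ge0.
Qed.

Local Arguments is_cvg_ell2_dot : clear implicits.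

Definition ell2_dot (x y : ell2) : R[i] :=
  limn (series (fun k => dotp (x k) (y k) : cplx R)).

Lemma ell2_dot_linear y a u v :
  ell2_dot (a *: u + v) y = a * ell2_dot u y + ell2_dot v y.
Proof.
rewrite {1}/ell2_dot; apply: (@cvg_lim (cplx R)) => //.
have -> : series (fun k => dotp ((a *: u + v) k) (y k) : cplx R) =
  a *: series (fun k => dotp (u k) (y k) : cplx R) +
  series (fun k => dotp (v k) (y k) : cplx R).
  apply/funext => n; rewrite /series /= -[RHS]/(a *: _ + _) scaler_sumr -big_split /=.
  by apply: eq_bigr => k _; rewrite -dotp_linear.
by apply: cvgD; [apply: cvgZl_tmp|]; apply: is_cvg_ell2_dot.
Qed.

Lemma ell2_dot_conj x y : ell2_dot x y = (ell2_dot y x)^*.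
Proof.
rewrite {1}/ell2_dot; apply: (@cvg_lim (cplx R)) => //.
have -> : series (fun k => dotp (x k) (y k) : cplx R) =
  (fun n => (series (fun k => dotp (y k) (x k) : cplx R) n : R[i])^*%R).
  apply/funext => n; rewrite /series /= rmorph_sum /=.
  by apply: eq_bigr => k _; rewrite dotp_conj.
exact: cvg_conj (is_cvg_ell2_dot y x).
Qed.

Lemma ell2_dotxx (x : ell2) :
  ell2_dot x x = (limn (series (fun k => rnorm (x k) ^+ 2)))%:C.
Proof.
rewrite {1}/ell2_dot; apply: (@cvg_lim (cplx R)) => //.
have -> : series (fun k => dotp (x k) (x k) : cplx R) =
  (fun n => (series (fun k => rnorm (x k) ^+ 2) n)%:C : cplx R).
  apply/funext => n; rewrite /series /= rmorph_sum /=.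
  by apply: eq_bigr => k _; rewrite dotp_norm rmorphXn /= rnormE.
exact: cvg_complex (ell2_summable x).
Qed.

Lemma ell2_partial_le (x : ell2) n :
  \sum_(k < n) rnorm (x k) ^+ 2 <= limn (series (fun k => rnorm (x k) ^+ 2)).
Proof.
have := nondecreasing_cvgn_le _ (ell2_summable x) n.
rewrite /series /= big_mkord; apply.
by apply: nondecreasing_series => k _ _; exact: sqr_ge0.
Qed.

Lemma ell2_dot_ge0 x : 0 <= ell2_dot x x.
Proof.
by rewrite ell2_dotxx ler0c; have := ell2_partial_le x 0; rewrite big_ord0.
Qed.

Lemma ell2_dot_eq0 x : ell2_dot x x = 0 -> x = 0.
Proof.
rewrite ell2_dotxx => -[x0]; apply/val_inj/funext => k /=.
have := ell2_partial_le x k.+1; rewrite x0 big_ord_recr /=.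
have s0 : 0 <= \sum_(i < k) rnorm (x i) ^+ 2 by apply: sumr_ge0 => i _; exact: sqr_ge0.
have k0 := sqr_ge0 (rnorm (x k)) => sk.
have /eqP : rnorm (x k) ^+ 2 = 0 by lra.
rewrite expf_eq0 /= => /eqP xk.
by apply/eqP; rewrite -normr_eq0 -rnormE xk.
Qed.

HB.instance Definition _ := Lmodule_isNormed.Build R[i] ell2
  (ipnormD ell2_dot_linear ell2_dot_conj ell2_dot_ge0 ell2_dot_eq0)
  (ipnormZ ell2_dot_linear ell2_dot_conj ell2_dot_ge0)
  (ipnorm0_eq0 ell2_dot_eq0).

Lemma ell2_dot_norm (x : ell2) : ell2_dot x x = `|x| ^+ 2.
Proof. by rewrite sqrtCK. Qed.

End Ell2Dot.
Arguments ell2_summable {R} x.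
Arguments is_cvg_ell2_dot {R} x y.

Section Ell2Complete.
Variable R : realType.
Local Open Scope complex_scope.
Local Notation ell2 := (ell2 R).
Implicit Types x y : nat -> cplx R.

Definition truncate N x : hsum N (cplx R) := [ffun i : 'I_N => x i].

Lemma truncate_normE N x :
  rnorm (truncate N x) ^+ 2 = \sum_(k < N) rnorm (x k) ^+ 2.
Proof.
suff : (rnorm (truncate N x) ^+ 2)%:C = (\sum_(k < N) rnorm (x k) ^+ 2)%:C by case.
rewrite rnormX_complex hsum_normE rmorph_sum /=; apply: eq_bigr => k _.
by rewrite ffunE rnormX_complex.
Qed.

Lemma ell2_normE (u : ell2) :
  rnorm u ^+ 2 = limn (series (fun k => rnorm (u k) ^+ 2)).
Proof.
suff : (rnorm u ^+ 2)%:C = (limn (series (fun k => rnorm (u k) ^+ 2)))%:C by case.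
by rewrite rnormX_complex -ell2_dot_norm ell2_dotxx.
Qed.

Lemma truncate_le N (u : ell2) : rnorm (truncate N u) <= rnorm u.
Proof.
rewrite -ler_sqr ?nnegrE ?rnorm_ge0 // truncate_normE ell2_normE.
exact: ell2_partial_le.
Qed.

Lemma ell2_norm_le (u : ell2) (e : R) : 0 <= e ->
  (forall N, rnorm (truncate N u) <= e) -> rnorm u <= e.
Proof.
move=> e0 ue; rewrite -ler_sqr ?nnegrE ?rnorm_ge0 // ell2_normE.
apply: limr_le; first exact: ell2_summable.
near=> N; rewrite /series /= big_mkord -truncate_normE ler_sqr ?nnegrE ?rnorm_ge0 //.
Unshelve. all: by end_near. Qed.

Lemma ell2_coord_le (u : ell2) k : rnorm (u k) <= rnorm u.
Proof.
apply: le_trans (truncate_le k.+1 u).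
have := hsum_coord_le (truncate k.+1 u) ord_max.
by rewrite ffunE -!rnormE lecR.
Qed.

Lemma ell2_complete (F : set_system ell2) : ProperFilter F -> cauchy F -> cvg F.
Proof.
move=> FF Fc.
have Fk k : cvg ((fun u : ell2 => u k) @ F).
  apply: cauchy_cvg; apply: (@cauchy_image _ _ ell2 (cplx R) _ F _ FF Fc) => e e0.
  exists e => // u v; apply: le_lt_trans.
  by have := ell2_coord_le (u - v) k; rewrite -lecR !rnormE.
pose l k := lim ((fun u : ell2 => u k) @ F).
have key (r : R) : 0 < r -> exists2 A, F A &
    forall u : ell2, A u -> forall N, rnorm (truncate N (val u - l)) <= r.
  move=> r0; have [|A FA Ar] := @cauchy_small _ ell2 F FF Fc r%:C.
    by rewrite ltcR.
  exists A => // u Au N; apply/ler_addgt0Pr => e e0.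
  have e1 : 0 < e%:C / N.+1%:R by rewrite divr_gt0 ?ltr0n // ltcR.
  have FB : F [set v : ell2 | forall i : 'I_N, `|l i - v i| <= e%:C / N.+1%:R].
    by apply: filter_forall => i; have /cvgrPdist_le := Fk i; exact.
  have [v [Av Bv]] := filter_ex (filterI FA FB).
  have -> : truncate N (val u - l) = truncate N (u - v) + truncate N (val v - l).
    by apply/ffunP => i; rewrite !ffunE subrKA.
  apply: le_trans (rnormD _ _) _; apply: lerD.
    apply: le_trans (truncate_le N (u - v)) _.
    by rewrite -lecR rnormE; exact/ltW/Ar.
  rewrite -lecR rnormE; apply: hsum_small => [|i]; first by rewrite lecR ltW.
  by rewrite ffunE distrC; exact: Bv.
have diff_in (u : ell2) (r : R) :
    (forall N, rnorm (truncate N (val u - l)) <= r) ->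
    (val u - l) \in @square_summable_pred R.
  move=> ur; apply/asboolP/square_summableP; exists (r ^+ 2) => n.
  rewrite -truncate_normE ler_sqr ?nnegrE ?rnorm_ge0 //.
  exact: le_trans (rnorm_ge0 _) (ur n).
have lP : l \in @square_summable_pred R.
  have [A FA A1] := key 1 ltr01; have [u Au] := filter_ex FA.
  have := rpredB (valP u) (diff_in u 1 (A1 u Au)).
  by rewrite /= opprB addrC subrK.
pose L : ell2 := Ell2 lP.
apply/cvg_ex; exists L; apply/cvgrPdist_le => e /complex_gt0[r r0 ->].
have [A FA Ar] := key r r0; apply: (@filterS _ F _ A) FA => u Au.
rewrite distrC -rnormE lecR; apply: ell2_norm_le => [|N]; first exact: ltW.
exact: Ar.
Qed.

HB.instance Definition _ := Uniform_isComplete.Build ell2 ell2_complete.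
HB.instance Definition _ := isHilbert.Build R ell2
  (@ell2_dot_linear R) (@ell2_dot_conj R) (@ell2_dot_norm R).

End Ell2Complete.

Section BoundedOperators.
Variables (R : realType) (H K : normedModType R[i]).

Definition bounded_op_pred : {pred H -> K} :=
  fun f => `[< linear f /\ continuous f >].

Lemma bounded_op_submod : submod_closed bounded_op_pred.
Proof.
split=> [|a f g /asboolP[fl fc] /asboolP[gl gc]]; apply/asboolP; split.
- by move=> a x y; rewrite scaler0 addr0.
- by move=> x; exact: cvg_cst.
- move=> b x y; rewrite -[LHS]/(a *: f (b *: x + y) + g (b *: x + y)) fl gl.
  rewrite -[in RHS]/(a *: f x + g x) -[in RHS]/(a *: f y + g y).
  by rewrite !scalerDr !scalerA (mulrC a) addrACA.
- move=> x; apply: cvgD; last exact: gc.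
  by apply: cvgZl_tmp; exact: fc.
Qed.

HB.instance Definition _ := GRing.isSubmodClosed.Build R[i] (H -> K)
  bounded_op_pred bounded_op_submod.

Record bounded_op :=
  BoundedOp { bounded_op_fun :> H -> K ; _ : bounded_op_fun \in bounded_op_pred }.

HB.instance Definition _ := [isSub for bounded_op_fun].
HB.instance Definition _ := [Choice of bounded_op by <:].
HB.instance Definition _ := [SubChoice_isSubLmodule of bounded_op by <:].

Definition opnorm (f : H -> K) : \bar R :=
  ereal_sup [set (rnorm (f x))%:E | x in [set x | rnorm x <= 1]].

End BoundedOperators.

Section BlockOperators.
Variables (R : realType) (H K : hilbertType R) (n : nat).

Definition block_op (A : 'I_n -> 'I_n -> H -> K) : hsum n H -> hsum n K :=
  fun v => [ffun i => \sum_j A i j (v j)].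

End BlockOperators.

(* A complex vector space with an extended real number attached to each square
   matrix over it.  No axiom is imposed: the spaces below carry the matrix norms
   that the constructions of operator space theory prescribe. *)
Record mnspace (R : realType) := MnSpace {
  mn_car :> lmodType R[i] ;
  mn_norm : forall n, 'M[mn_car]_n -> \bar R
}.
Arguments mn_norm {R} m {n} X.

Section MatrixNormedSpaces.
Variable R : realType.
Implicit Types E F : mnspace R.
Local Open Scope ereal_scope.

Definition mn_norm1 E (x : E) : \bar R := mn_norm E (const_mx x : 'M[E]_1).

(* M_n(B(H,K)) = B(H^n,K^n). *)
Definition opB (H K : hilbertType R) : mnspace R :=
  MnSpace (fun n (A : 'M[bounded_op H K]_n) => opnorm (block_op (fun i j => A i j))).

(* The operator space M_n = B(C^n), so that M_m(M_n) = B((C^n)^m). *)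
Definition mxB n : mnspace R :=
  @MnSpace R 'M[R[i]]_n (fun m (X : 'M['M[R[i]]_n]_m) =>
    opnorm (block_op (fun i j =>
      block_op (fun k l (z : cplx R) => (X i j k l *: z)%R)))).

Definition cbnorm E F (u : E -> F) : \bar R :=
  ereal_sup [set t | exists n, exists2 X : 'M[E]_n,
    mn_norm E X <= 1 & t = mn_norm F (map_mx u X)].

Definition completely_contractive E F (u : {linear E -> F}) : Prop :=
  cbnorm u <= 1.

Definition complete_isometry E F (u : {linear E -> F}) : Prop :=
  forall n (X : 'M[E]_n), mn_norm F (map_mx u X) = mn_norm E X.

(* Bounded linear functionals, for the norm of E = M_1(E). *)
Definition dual_pred E : {pred E -> cplx R} :=
  fun f => `[< linear f /\
    exists M : R, forall x, mn_norm1 x <= 1 -> (rnorm (f x) <= M)%R >].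

Lemma dual_submod E : submod_closed (@dual_pred E).
Proof.
split=> [|a f g /asboolP[fl [M fM]] /asboolP[gl [N gN]]]; apply/asboolP; split.
- by move=> a x y; rewrite scaler0 addr0.
- by exists 0%R => x _; rewrite /rnorm normr0.
- move=> b x y; rewrite -[LHS]/(a *: f (b *: x + y) + g (b *: x + y))%R fl gl.
  rewrite -[in RHS]/(a *: f x + g x)%R -[in RHS]/(a *: f y + g y)%R.
  by rewrite !scalerDr !scalerA (mulrC a) addrACA.
- exists (rnorm (a : cplx R) * M + N)%R => x x1.
  rewrite -[X in rnorm X]/(a *: f x + g x)%R; apply: le_trans (rnormD _ _) _.
  rewrite (rnormZ (a : cplx R)); apply: lerD; last exact: gN.
  by apply: ler_wpM2l; [exact: rnorm_ge0 | exact: fM].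
Qed.

HB.instance Definition _ E := GRing.isSubmodClosed.Build R[i] (E -> cplx R)
  (@dual_pred E) (@dual_submod E).

Record functional E :=
  Functional { functional_fun :> E -> cplx R ; _ : functional_fun \in @dual_pred E }.

HB.instance Definition _ E := [isSub for @functional_fun E].
HB.instance Definition _ E := [Choice of functional E by <:].
HB.instance Definition _ E := [SubChoice_isSubLmodule of functional E by <:].

(* M_n(E^* ) = cb(E, M_n). *)
Definition dual E : mnspace R :=
  MnSpace (fun n (f : 'M[functional E]_n) =>
    @cbnorm E (mxB n) (fun x => \matrix_(i, j) f i j x)).

End MatrixNormedSpaces.

Section Conjugate.
Variable R : realType.

(* The same additive group, with a acting as its conjugate. *)
Definition conj_of (V : Type) : Type := V.

Section ConjLmodule.
Variable V : lmodType R[i].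

HB.instance Definition _ := GRing.Zmodule.copy (conj_of V) V.

Definition conj_scale (a : R[i]) (x : conj_of V) : conj_of V :=
  a^* *: (x : V).

Let conj_scaleA a b x : conj_scale a (conj_scale b x) = conj_scale (a * b) x.
Proof. by rewrite /conj_scale rmorphM scalerA. Qed.
Let conj_scale1 : left_id 1 conj_scale.
Proof. by move=> x; rewrite /conj_scale rmorph1 scale1r. Qed.
Let conj_scaleDr : right_distributive conj_scale +%R.
Proof. by move=> a x y; rewrite /conj_scale scalerDr. Qed.
Let conj_scaleDl x : {morph conj_scale^~ x : a b / a + b}.
Proof. by move=> a b; rewrite /conj_scale rmorphD scalerDl. Qed.

HB.instance Definition _ := GRing.Zmodule_isLmodule.Build R[i] (conj_of V)
  conj_scaleA conj_scale1 conj_scaleDr conj_scaleDl.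

End ConjLmodule.

(* If E is a subspace of B(H), a matrix over E acts on the n-fold sum of the
   conjugate of H by the same map, with the same norm of vectors, as on the n-fold
   sum of H: the matrix norms do not change. *)
Definition mn_conj (E : mnspace R) : mnspace R :=
  MnSpace (fun n (X : 'M[conj_of E]_n) => mn_norm E (X : 'M[E]_n)).

End Conjugate.

Section Sums.
Variables (R : realType) (E F : mnspace R).
Local Open Scope ereal_scope.

Definition sum_inf : mnspace R :=
  @MnSpace R (E * F)%type (fun n (X : 'M[(E * F)%type]_n) =>
    maxe (mn_norm E (map_mx fst X)) (mn_norm F (map_mx snd X))).

End Sums.

(* The norm induced by cb(E^* (+)_oo F^*, M_n). *)
Definition sum_one (R : realType) (E F : mnspace R) : mnspace R :=
  @MnSpace R (E * F)%type (fun n (X : 'M[(E * F)%type]_n) =>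
    @cbnorm R (sum_inf (dual E) (dual F)) (mxB R n)
      (fun fg => \matrix_(i, j) (fg.1 (X i j).1 + fg.2 (X i j).2))).

Section Subspace.
Variables (R : realType) (V : lmodType R[i]) (S : submodClosed V).

Record subspace_of := SubspaceOf { subspace_val : V ; _ : subspace_val \in S }.

HB.instance Definition _ := [isSub for subspace_val].
HB.instance Definition _ := [Choice of subspace_of by <:].
HB.instance Definition _ := [SubChoice_isSubLmodule of subspace_of by <:].

End Subspace.

(* The matrix norms that V receives from E through j. *)
Definition mn_along (R : realType) (V : lmodType R[i]) (E : mnspace R)
    (j : V -> E) : mnspace R :=
  @MnSpace R V (fun n (X : 'M[V]_n) => mn_norm E (map_mx j X)).

Definition mn_sub (R : realType) (E : mnspace R) (S : submodClosed E) : mnspace R :=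
  mn_along (val : subspace_of S -> E).

Section Quotient.
Variables (R : realType) (V : lmodType R[i]) (S : submodClosed V).
Local Open Scope quotient_scope.

Definition quot_pred : {pred V} := fun x => x \in S.

Lemma quot_pred_zmod : zmod_closed quot_pred.
Proof.
split=> [|x y xS yS]; first exact: (rpred0 S).
by rewrite -[- y]scaleN1r; apply: (rpredD xS); apply: rpredZ.
Qed.

HB.instance Definition _ := GRing.isZmodClosed.Build V quot_pred quot_pred_zmod.

Definition quot_of : Type := Quotient.quot quot_pred.
HB.instance Definition _ := GRing.Zmodule.copy quot_of (Quotient.quot quot_pred).

Definition quot_proj (x : V) : quot_of := \pi_(Quotient.quot quot_pred) x.

Lemma quot_projP x y : reflect (quot_proj x = quot_proj y) (x - y \in S).
Proof. by rewrite -[_ \in S]/(_ \in quot_pred) Quotient.idealrBE; exact: eqP. Qed.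

Lemma quot_projD : {morph quot_proj : x y / x + y}.
Proof. exact: Quotient.pi_add. Qed.

Lemma quot_proj_surj (q : quot_of) : quot_proj (repr q) = q.
Proof. exact: reprK. Qed.

Definition quot_scale (a : R[i]) (q : quot_of) : quot_of :=
  quot_proj (a *: repr q).

Lemma quot_projZ a x : quot_proj (a *: x) = quot_scale a (quot_proj x).
Proof.
apply/quot_projP; rewrite -scalerBr; apply: rpredZ.
by apply/quot_projP; rewrite quot_proj_surj.
Qed.

Let quot_scaleA a b x : quot_scale a (quot_scale b x) = quot_scale (a * b) x.
Proof. by rewrite -[x]quot_proj_surj -!quot_projZ scalerA. Qed.
Let quot_scale1 : left_id 1 quot_scale.
Proof. by move=> x; rewrite -[x]quot_proj_surj -quot_projZ scale1r. Qed.
Let quot_scaleDr : right_distributive quot_scale +%R.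
Proof.
move=> a x y; rewrite -[x]quot_proj_surj -[y]quot_proj_surj.
by rewrite -quot_projD -!quot_projZ scalerDr quot_projD.
Qed.
Let quot_scaleDl x : {morph quot_scale^~ x : a b / a + b}.
Proof.
move=> a b; rewrite -[x]quot_proj_surj.
by rewrite -!quot_projZ scalerDl quot_projD.
Qed.

HB.instance Definition _ := GRing.Zmodule_isLmodule.Build R[i] quot_of
  quot_scaleA quot_scale1 quot_scaleDr quot_scaleDl.

Lemma quot_proj_linear : linear quot_proj.
Proof. by move=> a x y; rewrite quot_projD quot_projZ. Qed.

HB.instance Definition _ := GRing.isLinear.Build R[i] V quot_of _ quot_proj
  quot_proj_linear.

End Quotient.

Definition mn_quot (R : realType) (E : mnspace R) (S : submodClosed E) : mnspace R :=
  @MnSpace R (quot_of S) (fun n (X : 'M[quot_of S]_n) =>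
    ereal_inf [set mn_norm E Y | Y in [set Y : 'M[E]_n | map_mx (quot_proj S) Y = X]]).

Lemma linear_le_continuous (R : realType) (V W : normedModType R[i])
    (f : V -> W) (M : R[i]) :
  linear f -> 0 <= M -> (forall x, `|f x| <= M * `|x|) -> continuous f.
Proof.
move=> fl M0 fM x; apply/cvgrPdist_lt => e e0.
have fB u v : f u - f v = f (u - v).
  by have := fl (-1) v u; rewrite !scaleN1r ![- _ + _]addrC.
have M1 : 0 < M + 1 by rewrite ltr_wpDl.
have e1 : 0 < e / (M + 1) by rewrite divr_gt0.
have : \forall y \near x, `|x - y| < e / (M + 1).
  by apply/nbhs_normP; exists (e / (M + 1)) => //= y.
apply: filterS => y; rewrite fB ltr_pdivlMr // => xy.
apply: le_lt_trans (fM _) _; apply: le_lt_trans xy.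
by rewrite mulrC ler_wpM2l // lerDl.
Qed.

Section RowColumn.
Variable R : realType.
Local Notation ell2 := (ell2 R).

Lemma col_op_subproof (x : ell2) :
  (fun z : cplx R => (z : R[i]) *: x) \in @bounded_op_pred R (cplx R) ell2.
Proof.
apply/asboolP; have l : linear (fun z : cplx R => (z : R[i]) *: x).
  by move=> a u v /=; rewrite scalerDl scalerA.
split=> //; apply: (linear_le_continuous l (M := `|x|)) => // z.
by rewrite normrZ mulrC.
Qed.

Definition col_op (x : ell2) : bounded_op (cplx R) ell2 :=
  BoundedOp (col_op_subproof x).

Lemma conj_summable (x : ell2) :
  (fun k => (x k : R[i])^* : cplx R) \in @square_summable_pred R.
Proof.
apply/asboolP; rewrite /square_summable.
have -> : (fun k => rnorm ((x k : R[i])^* : cplx R) ^+ 2) =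
          (fun k => rnorm (x k) ^+ 2).
  apply/funext => k; congr ((complex.Re _) ^+ 2).
  exact: (norm_conjC (x k : R[i])).
exact: ell2_summable.
Qed.

Definition ell2_conj (x : ell2) : ell2 := Ell2 (conj_summable x).

(* The pairing is bilinear: [row_op] sends the basis vector e_k to the row
   matrix unit e_1k. *)
Definition row_fun (x y : ell2) : cplx R :=
  limn (series (fun k => (x k : R[i]) * (y k : R[i]) : cplx R)).

Lemma row_funE x y : row_fun x y = ell2_dot y (ell2_conj x).
Proof.
congr (limn (series _)); apply/funext => k /=.
by rewrite -[RHS]/((y k : R[i]) * ((x k : R[i])^*)^*) conjCK mulrC.
Qed.

Lemma row_op_subproof (x : ell2) : row_fun x \in @bounded_op_pred R ell2 (cplx R).
Proof.
apply/asboolP; have l : linear (row_fun x).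
  by move=> a u v; rewrite !row_funE ell2_dot_linear.
split=> //; apply: (linear_le_continuous l (M := `|ell2_conj x|)) => // y.
rewrite row_funE -ler_sqr ?nnegrE ?mulr_ge0 // exprMn -!ell2_dot_norm mulrC.
apply: ip_CS; [exact: ell2_dot_linear | exact: ell2_dot_conj
  | exact: ell2_dot_ge0 | exact: ell2_dot_eq0].
Qed.

Definition row_op (x : ell2) : bounded_op ell2 (cplx R) :=
  BoundedOp (row_op_subproof x).

(* C = B(C,l2) and R = B(l2,C), both carried by l2. *)
Definition colH : mnspace R := mn_along (col_op : ell2 -> opB (cplx R) ell2).
Definition rowH : mnspace R := mn_along (row_op : ell2 -> opB ell2 (cplx R)).

Definition diag_pred : {pred sum_inf colH rowH} :=
  fun w => w.1 == w.2 :> ell2.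

Lemma diag_submod : submod_closed diag_pred.
Proof.
split=> [|a u v /eqP uE /eqP vE]; first exact: eqxx.
by apply/eqP; rewrite /= uE vE.
Qed.

HB.instance Definition _ := GRing.isSubmodClosed.Build R[i] (sum_inf colH rowH)
  diag_pred diag_submod.

Definition antidiag_pred : {pred sum_one colH rowH} :=
  fun w => w.2 == - w.1 :> ell2.

Lemma antidiag_submod : submod_closed antidiag_pred.
Proof.
split=> [|a u v /eqP uE /eqP vE]; first by apply/eqP; rewrite /= oppr0.
by apply/eqP; rewrite /= uE vE opprD scalerN.
Qed.

HB.instance Definition _ := GRing.isSubmodClosed.Build R[i] (sum_one colH rowH)
  antidiag_pred antidiag_submod.

Definition capCR : mnspace R := mn_sub diag_pred.
Definition sumCR : mnspace R := mn_quot antidiag_pred.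

End RowColumn.

(* A Banach space with an isometric embedding in some B(H); the image is closed
   because the space is complete. *)
Record opspace (R : realType) := OpSpace {
  os_car :> completeNormedModType R[i] ;
  os_hilb : hilbertType R ;
  os_emb : {linear os_car -> bounded_op os_hilb os_hilb} ;
  os_isom : forall x, opnorm (os_emb x) = (rnorm x)%:E
}.

Definition os_mn (R : realType) (E : opspace R) : mnspace R :=
  mn_along (os_emb E : os_car E -> opB (os_hilb E) (os_hilb E)).

Lemma opnorm_block1 (R : realType) (H K : hilbertType R) (A : 'I_1 -> 'I_1 -> H -> K) :
  opnorm (block_op A) = opnorm (A 0 0).
Proof.
have n1 (L : hilbertType R) (v : hsum 1 L) : rnorm v = rnorm (v 0).
  apply/eqP; rewrite -(eqrXn2 (n := 2)) ?rnorm_ge0 //; apply/eqP.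
  suff : (rnorm v ^+ 2)%:C%C = (rnorm (v 0) ^+ 2)%:C%C by case.
  by rewrite !rnormX_complex hsum_normE big_ord1.
rewrite /opnorm; congr ereal_sup; apply/seteqP; split=> _ [v /= v1 <-].
  by exists (v 0); rewrite /= -?n1 // n1 ffunE big_ord1.
exists ([ffun _ => v] : hsum 1 H); rewrite /= n1 ffunE //.
by rewrite big_ord1 ffunE.
Qed.

Lemma os_norm1 (R : realType) (E : opspace R) (x : E) :
  @mn_norm1 R (os_mn E) x = (rnorm x)%:E.
Proof. by rewrite -os_isom /mn_norm1 /= opnorm_block1 !mxE. Qed.

Section OH.
Variables (R : realType) (E : opspace R) (c : {linear E -> ell2 R}).
Hypothesis c_isom : forall x, `|c x| = `|x|.

Lemma riesz_subproof (x : E) :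
  (fun y : E => dotp (c y) (c x) : cplx R) \in @dual_pred R (os_mn E).
Proof.
apply/asboolP; split.
  by move=> a u v; rewrite linearP dotp_linear.
exists (rnorm x) => y; rewrite os_norm1 lee_fin => y1.
suff : rnorm (dotp (c y) (c x) : cplx R) <= rnorm y * rnorm x.
  by move=> /le_trans; apply; rewrite ler_piMl ?rnorm_ge0.
rewrite -lecR rmorphM /= !rnormE -!c_isom.
rewrite -ler_sqr ?nnegrE ?mulr_ge0 // exprMn -!ell2_dot_norm.
apply: ip_CS; [exact: ell2_dot_linear | exact: ell2_dot_conj
  | exact: ell2_dot_ge0 | exact: ell2_dot_eq0].
Qed.

(* The map x |-> <.,x> into the antidual. *)
Definition riesz_fun (x : E) : mn_conj (dual (os_mn E)) :=
  Functional (riesz_subproof x).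

Lemma riesz_linear : linear riesz_fun.
Proof.
move=> a u v; apply/val_inj/funext => y.
rewrite /= linearP dotp_conj dotp_linear rmorphD rmorphM /= -!dotp_conj.
by [].
Qed.

End OH.

HB.instance Definition _ (R : realType) (E : opspace R) (c : {linear E -> ell2 R})
    (c_isom : forall x, `|c x| = `|x|) :=
  GRing.isLinear.Build R[i] (os_mn E) (mn_conj (dual (os_mn E))) _
    (riesz_fun c_isom) (riesz_linear c_isom).

(* [OH] is only determined up to complete isometry, so it enters as any
   operator space with the defining properties, together with the coordinates
   [oh_coord] in an orthonormal basis (inverse [oh_of]). *)
Record OHspace (R : realType) := MkOHspace {
  oh_space :> opspace R ;
  oh_coord : {linear oh_space -> ell2 R} ;
  oh_of : {linear ell2 R -> oh_space} ;
  oh_coordK : cancel oh_coord oh_of ;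
  oh_ofK : cancel oh_of oh_coord ;
  oh_isom : forall x, `|oh_coord x| = `|x| ;
  oh_selfdual : complete_isometry
    (riesz_fun oh_isom : {linear os_mn oh_space -> mn_conj (dual (os_mn oh_space))})
}.

Section Inclusions.
Variables (R : realType) (OH : OHspace R).

Definition cap_to_OH (w : capCR R) : os_mn OH := oh_of OH (val w).1.

Lemma cap_to_OH_linear : linear cap_to_OH.
Proof. by move=> a u v; rewrite -[RHS](linearP (oh_of OH)). Qed.

HB.instance Definition _ := GRing.isLinear.Build R[i] (capCR R) (os_mn OH) _
  cap_to_OH cap_to_OH_linear.

(* The classes of (x,0) and (0,x) are equal, so the inclusion of l2 in C + R can
   be written with either summand. *)
Definition OH_to_sum (x : os_mn OH) : sumCR R :=
  quot_proj (@antidiag_pred R) (oh_coord OH x, 0).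

Lemma OH_to_sum_linear : linear OH_to_sum.
Proof.
move=> a u v; rewrite -[RHS](linearP (quot_proj (@antidiag_pred R))).
congr quot_proj; congr pair; first exact: linearP.
by rewrite -[RHS]/(a *: 0 + 0 : ell2 R) scaler0 addr0.
Qed.

HB.instance Definition _ := GRing.isLinear.Build R[i] (os_mn OH) (sumCR R) _
  OH_to_sum OH_to_sum_linear.

End Inclusions.

Arguments cap_to_OH {R} OH w.
Arguments OH_to_sum {R} OH x.

(* Main.v *)
Require Import Defs.
From mathcomp Require Import all_boot all_order all_algebra.
From mathcomp Require Import all_classical all_reals all_analysis.
From mathcomp Require Import spectral sesquilinear.
From mathcomp.real_closed Require Import complex.
From mathcomp Require Import ring.

Set Implicit Arguments.
Unset Strict Implicit.
Unset Printing Implicit Defensive.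
Import Order.TTheory GRing.Theory Num.Theory.
Local Open Scope ring_scope.

(** Self-duality of OH, tested on a matrix X = sum_k x_k (x) e_k of norm at most
    1 against itself, says that Phi(T) = sum_k x_k T x_k^* is a contraction for
    the Hilbert-Schmidt norm.  For c > 1, iterating the pair
    (T, S) |-> (1 + Phi^*(S)/c, 1 + Phi(T)/c) from (1, 1) gives S, T >= 1 with
    Phi(T) <= c S and Phi^*(S) <= c T.  Split X = A + B by solving the Sylvester
    equation S A + A T = S X.  Then S B + B T = X T, and an arithmetic-geometric
    mean argument at a top singular vector bounds A in M_n(C) and B in M_n(R) by
    sqrt(c) / 2.  Hence X has norm at most sqrt(c) in M_n(C + R).  By self-duality
    again, the norm in M_n(OH) of a matrix over the intersection of C and R is
    estimated by pairing it with such sums A + B, since C pairs with R and R with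
    C by the Cauchy-Schwarz inequality. *)

(** * Positive semidefinite matrices and the spectral theorem *)

Section PositiveMatrices.
Variables (C : numClosedFieldType) (n : nat).
Implicit Types (M S T : 'M[C]_n) (z : 'I_n -> C).

Definition quad_form M z : C := \sum_i \sum_j M i j * z j * (z i)^*.

Definition psdmx M : Prop :=
  (forall i j, M j i = (M i j)^*) /\ forall z, 0 <= quad_form M z.

Lemma quad_formD M N z : quad_form (M + N) z = quad_form M z + quad_form N z.
Proof.
rewrite /quad_form -big_split; apply: eq_bigr => i _; rewrite -big_split.
by apply: eq_bigr => j _; rewrite mxE !mulrDl.
Qed.

Lemma quad_formZ a M z : quad_form (a *: M) z = a * quad_form M z.
Proof.
rewrite /quad_form mulr_sumr; apply: eq_bigr => i _; rewrite mulr_sumr.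
by apply: eq_bigr => j _; rewrite mxE !mulrA.
Qed.

Lemma quad_form1 z : quad_form 1%:M z = \sum_i `|z i| ^+ 2.
Proof.
apply: eq_bigr => i _; rewrite (bigD1 i) //= big1 => [|j ji].
  by rewrite mxE eqxx mul1r addr0 normCK.
by rewrite mxE eq_sym (negPf ji) !mul0r.
Qed.

Lemma quad_formB M N z : quad_form (M - N) z = quad_form M z - quad_form N z.
Proof. by rewrite -[- N]scaleN1r quad_formD quad_formZ mulN1r. Qed.

Lemma psdmx1 : psdmx 1%:M.
Proof.
split=> [i j|z]; first by rewrite !mxE conjC_nat eq_sym.
by rewrite quad_form1; apply: sumr_ge0 => i _; rewrite exprn_ge0.
Qed.

Lemma psdmxD M N : psdmx M -> psdmx N -> psdmx (M + N).
Proof.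
move=> [Mh M0] [Nh N0]; split=> [i j|z]; first by rewrite !mxE rmorphD /= -Mh -Nh.
by rewrite quad_formD addr_ge0.
Qed.

Lemma psdmxZ a M : 0 <= a -> psdmx M -> psdmx (a *: M).
Proof.
move=> a0 [Mh M0]; split=> [i j|z]; last by rewrite quad_formZ mulr_ge0.
by rewrite !mxE rmorphM /= -Mh geC0_conj.
Qed.

(** The form of the transpose at [z] is the form of [M] at the conjugate of [z]. *)
Lemma psdmx_tr M : psdmx M -> psdmx M^T.
Proof.
move=> [Mh M0]; split=> [i j|z]; first by rewrite !mxE.
have := M0 (fun i => (z i)^*); congr (0 <= _).
rewrite /quad_form exchange_big; apply: eq_bigr => i _; apply: eq_bigr => j _.
by rewrite mxE conjCK mulrAC.
Qed.

(** The rows of [P] are an orthonormal basis of eigenvectors. As [spectralmx M] diagonalizes [M] in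
    the form Q^* D Q, [P] is the entrywise conjugate of Q. *)
Lemma hermitian_diag M : (forall i j, M j i = (M i j)^*) ->
  exists (P : 'M[C]_n) (d : 'I_n -> C),
    [/\ forall i j, \sum_k P i k * (P j k)^* = (i == j)%:R,
        forall i j, \sum_k P k i * (P k j)^* = (i == j)%:R
      & forall i j, M i j = \sum_k d k * P k i * (P k j)^*].
Proof.
move=> Mh.
have Mn : M \is normalmx.
  apply: hermitian_normalmx; apply/is_hermitianmxP; rewrite expr0 scale1r.
  by apply/matrixP => i j; rewrite !mxE -Mh.
move/orthomx_spectralP: Mn; set Q := spectralmx M; set D := spectral_diag M.
move=> Mdec; have Qu : Q \is unitarymx by exact: spectral_unitarymx.
rewrite (invmx_unitary Qu) in Mdec.
exists (\matrix_(i, j) (Q i j)^*), (fun k => D 0 k); split=> i j.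
- have /unitarymxP/matrixP/(_ j i) := Qu; rewrite !mxE eq_sym => <-.
  by apply: eq_bigr => k _; rewrite !mxE conjCK mulrC.
- have := Qu; rewrite -trmx_unitary => /unitarymxP/matrixP/(_ j i).
  rewrite !mxE eq_sym => <-.
  by apply: eq_bigr => k _; rewrite !mxE conjCK mulrC.
- rewrite [in LHS]Mdec mul_mx_diag !mxE; apply: eq_bigr => k _.
  by rewrite !mxE conjCK; ring.
Qed.

Lemma quad_form_diag M (P : 'M[C]_n) (d : 'I_n -> C) :
  (forall i j, M i j = \sum_k d k * P k i * (P k j)^*) ->
  forall z, quad_form M z = \sum_k d k * `|\sum_j z j * (P k j)^*| ^+ 2.
Proof.
move=> Md z; rewrite /quad_form.
under eq_bigr do under eq_bigr do rewrite Md !mulr_suml.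
under eq_bigr do rewrite exchange_big /=.
rewrite exchange_big; apply: eq_bigr => k _.
rewrite normCK rmorph_sum mulr_suml mulr_sumr exchange_big.
apply: eq_bigr => j _; rewrite !mulr_sumr; apply: eq_bigr => i _.
by rewrite rmorphM /= conjCK; ring.
Qed.

Lemma psdmx_factor M : psdmx M ->
  exists P : 'M[C]_n, forall i j, M i j = \sum_k P k i * (P k j)^*.
Proof.
move=> [Mh M0]; have [P [d [Pr Pc Md]]] := hermitian_diag Mh.
(* The eigenvalue [d k] is the value of the form at the eigenvector [P k]. *)
have d0 k : 0 <= d k.
  have := M0 (P k); rewrite (quad_form_diag Md) (bigD1 k) //= Pr eqxx.
  rewrite normr1 expr1n mulr1 big1 ?addr0 // => l lk.
  by rewrite Pr eq_sym (negPf lk) normr0 expr0n mulr0.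
exists (\matrix_(i, j) (sqrtC (d i) * P i j)) => i j; rewrite Md.
apply: eq_bigr => k _; rewrite !mxE rmorphM /= (@geC0_conj _ (sqrtC (d k))) ?sqrtC_ge0 //.
by have := sqrtCK (d k); rewrite expr2 => {1}<-; ring.
Qed.

End PositiveMatrices.

(** * Cauchy-Schwarz inequalities for finite families of vectors *)

Section HilbertSums.
Variables (R : realType) (H : hilbertType R).
Implicit Types (x y : H) (a : R[i]).

Lemma dotpDl x y z : dotp (x + y) z = dotp x z + dotp y z.
Proof. by have := dotp_linear z 1 x y; rewrite scale1r mul1r. Qed.

Lemma dotp0l z : dotp (0 : H) z = 0.
Proof. by apply: (addrI (dotp 0 z)); rewrite -dotpDl !addr0. Qed.

Lemma dotpZl a x z : dotp (a *: x) z = a * dotp x z.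
Proof. by have := dotp_linear z a x 0; rewrite addr0 dotp0l addr0. Qed.

Lemma dotp_suml (I : finType) (u : I -> H) z :
  dotp (\sum_i u i) z = \sum_i dotp (u i) z.
Proof. by apply: (big_morph _ (fun x y => dotpDl x y z)); exact: dotp0l. Qed.

Lemma dotpZr a x z : dotp x (a *: z) = a^* * dotp x z.
Proof. by rewrite dotp_conj dotpZl rmorphM /= -dotp_conj. Qed.

Lemma dotp_sumr (I : finType) (u : I -> H) z :
  dotp z (\sum_i u i) = \sum_i dotp z (u i).
Proof.
rewrite dotp_conj dotp_suml rmorph_sum.
by apply: eq_bigr => i _; rewrite /= -dotp_conj.
Qed.

(** This is Cauchy-Schwarz in a Hilbert sum of copies of [H]; the index is any finite type because
    later double sums run over pairs. *)
Lemma sum_CS (I : finType) (u v : I -> H) :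
  `|\sum_i dotp (u i) (v i)| ^+ 2 <= (\sum_i `|u i| ^+ 2) * (\sum_i `|v i| ^+ 2).
Proof.
pose d (f g : {ffun I -> H}) : R[i] := \sum_i dotp (f i) (g i).
have dl z (a : R[i]) f g : d (a *: f + g) z = a * d f z + d g z.
  rewrite /d mulr_sumr -big_split; apply: eq_bigr => i _.
  by rewrite !ffunE dotp_linear.
have dC f g : d f g = (d g f)^*.
  by rewrite /d rmorph_sum; apply: eq_bigr => i _; rewrite dotp_conj.
have d0 f : 0 <= d f f by apply: sumr_ge0 => i _; rewrite dotp_norm exprn_ge0.
have dN f : d f f = 0 -> f = 0.
  move=> /eqP; rewrite psumr_eq0 => [/allP f0|i _]; last by rewrite dotp_norm exprn_ge0.
  apply/ffunP => i; rewrite ffunE; apply/eqP.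
  by have := f0 i (mem_index_enum _); rewrite dotp_norm expf_eq0 /= normr_eq0.
have := ip_CS dl dC d0 dN [ffun i => u i] [ffun i => v i].
rewrite /d; under eq_bigr do rewrite !ffunE.
by congr (_ <= _ * _); apply: eq_bigr => i _; rewrite !ffunE dotp_norm.
Qed.

End HilbertSums.

Section Sesquilinear.
Variables (R : realType) (H : hilbertType R) (n : nat).
Implicit Types (S T : 'M[R[i]]_n) (u v : 'I_n -> H).

(** The inner product of (S tensor 1) u with v in H^n. *)
Definition gform S u v : R[i] := \sum_i \sum_p S i p * dotp (u p) (v i).

(** With [S] = Q^* Q, where Q is the entrywise conjugate of [P], the form becomes the inner product
    of Q u and Q v; positivity and Cauchy-Schwarz follow. *)
Lemma gform_factor S : psdmx S -> exists P : 'M[R[i]]_n, forall u v,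
  gform S u v =
  \sum_k dotp (\sum_p (P k p)^* *: u p) (\sum_i (P k i)^* *: v i).
Proof.
move=> /psdmx_factor[P SP]; exists P => u v; rewrite /gform.
under eq_bigr do under eq_bigr do rewrite SP mulr_suml.
under eq_bigr do rewrite exchange_big /=.
rewrite exchange_big; apply: eq_bigr => k _; rewrite dotp_sumr.
apply: eq_bigr => i _; rewrite dotp_suml; apply: eq_bigr => p _.
by rewrite dotpZl dotpZr conjCK mulrCA mulrA.
Qed.

Lemma gform_ge0 S u : psdmx S -> 0 <= gform S u u.
Proof.
move=> /gform_factor[P ->]; apply: sumr_ge0 => k _.
by rewrite dotp_norm exprn_ge0.
Qed.

Lemma gform_CS S u v : psdmx S ->
  `|gform S u v| ^+ 2 <= gform S u u * gform S v v.
Proof.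
move=> /gform_factor[P SP]; rewrite !SP; apply: le_trans (sum_CS _ _) _.
by under eq_bigr do rewrite -dotp_norm;
   under [X in _ * X <= _]eq_bigr do rewrite -dotp_norm.
Qed.

Lemma gform1 u v : gform 1%:M u v = \sum_i dotp (u i) (v i).
Proof.
apply: eq_bigr => i _; rewrite (bigD1 i) //= big1 ?addr0 => [|j ji].
  by rewrite mxE eqxx mul1r.
by rewrite mxE eq_sym (negPf ji) mul0r.
Qed.

End Sesquilinear.

(** * The positive maps Phi and Phi^* of a matrix of vectors, and the Hilbert-Schmidt norm *)

Section GramMap.
Variables (R : realType) (H : hilbertType R) (n : nat).
Implicit Types (X : 'M[H]_n) (S T : 'M[R[i]]_n) (z : 'I_n -> R[i]).

Definition vapply X z (i : 'I_n) : H := \sum_j z j *: X i j.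

(* If X is the tensor of the matrices x_k with an orthonormal basis, then
   [gram_adj X S] is the sum of the x_k^* S x_k. *)
Definition gram_adj X S : 'M[R[i]]_n :=
  \matrix_(l, j) \sum_k \sum_i dotp (X i j) (X k l) * S k i.

(** In the same notation this is the sum of the x_k T x_k^*. Passing through transposes lets
    additivity and positivity carry over from [gram_adj]. *)
Definition gram_map X T : 'M[R[i]]_n := (gram_adj X^T T^T)^T.

Lemma gram_adjD X S T : gram_adj X (S + T) = gram_adj X S + gram_adj X T.
Proof.
apply/matrixP => l j; rewrite !mxE -big_split; apply: eq_bigr => k _.
by rewrite -big_split; apply: eq_bigr => i _; rewrite mxE mulrDr.
Qed.

Lemma gram_mapD X S T : gram_map X (S + T) = gram_map X S + gram_map X T.
Proof. by rewrite /gram_map linearD gram_adjD linearD. Qed.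

(** As [gram_adj X S] is X^* (S tensor 1) X, the outer X^* moves to the other side of the inner
    product. *)
Lemma quad_form_gram_adj X S z :
  quad_form (gram_adj X S) z = gform S (vapply X z) (vapply X z).
Proof.
rewrite /quad_form /gform.
under eq_bigr do under eq_bigr do rewrite mxE !mulr_suml.
under eq_bigr do rewrite exchange_big /=.
rewrite exchange_big; apply: eq_bigr => k _ /=.
under eq_bigr do under eq_bigr do rewrite !mulr_suml.
under eq_bigr do rewrite exchange_big /=.
rewrite exchange_big; apply: eq_bigr => i _ /=.
rewrite dotp_sumr mulr_sumr; apply: eq_bigr => l _.
rewrite dotp_suml mulr_sumr; apply: eq_bigr => j _.
by rewrite dotpZl dotpZr; ring.
Qed.

Lemma psdmx_gram_adj X S : psdmx S -> psdmx (gram_adj X S).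
Proof.
move=> Sp; split=> [l j|z]; last by rewrite quad_form_gram_adj gform_ge0.
rewrite !mxE rmorph_sum exchange_big; apply: eq_bigr => k _ /=.
rewrite rmorph_sum; apply: eq_bigr => i _ /=.
by rewrite rmorphM /= -dotp_conj; case: Sp => ->.
Qed.

Lemma psdmx_gram_map X T : psdmx T -> psdmx (gram_map X T).
Proof. by move=> Tp; apply/psdmx_tr/psdmx_gram_adj/psdmx_tr. Qed.

End GramMap.

Section HilbertSchmidt.
Variables (R : realType) (n : nat).
Implicit Types (M S T : 'M[R[i]]_n).

Definition hs_sqnorm M : R[i] := \sum_(p : 'I_n * 'I_n) `|M p.1 p.2| ^+ 2.

Lemma hs_sqnorm_ge0 M : 0 <= hs_sqnorm M.
Proof. by apply: sumr_ge0 => p _; rewrite exprn_ge0. Qed.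

Lemma hs_sqnormZ a M : hs_sqnorm (a *: M) = `|a| ^+ 2 * hs_sqnorm M.
Proof.
by rewrite /hs_sqnorm mulr_sumr; apply: eq_bigr => p _; rewrite mxE normrM exprMn.
Qed.

Lemma hs_sqnorm_1 : hs_sqnorm 1%:M = n%:R.
Proof.
rewrite /hs_sqnorm -(pair_bigA _ (fun i j => `|1%:M i j| ^+ 2)) /=.
rewrite -[n in RHS]card_ord -sumr_const; apply: eq_bigr => i _.
rewrite (bigD1 i) //= big1 ?addr0 => [|j ji].
  by rewrite mxE eqxx normr1 expr1n.
by rewrite mxE eq_sym (negPf ji) normr0 expr0n.
Qed.

Lemma scalar_CS (I : finType) (a b : I -> R[i]) :
  `|\sum_i a i * (b i)^*| ^+ 2 <= (\sum_i `|a i| ^+ 2) * (\sum_i `|b i| ^+ 2).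
Proof. exact: (@sum_CS R (cplx R) I a b). Qed.

(** The Hilbert-Schmidt norm dominates the operator norm: the form of [M] at [z] is the
    Hilbert-Schmidt inner product of [M] with the rank one matrix z z^*, and Cauchy-Schwarz
    applies. *)
Lemma psdmx_subr1 M : psdmx M -> hs_sqnorm M <= 1 -> psdmx (1%:M - M).
Proof.
move=> Mp M1; split=> [i j|z].
  by rewrite !mxE rmorphB /= -(proj1 Mp) conjC_nat eq_sym.
rewrite quad_formB quad_form1 subr_ge0.
have z0 : 0 <= \sum_i `|z i| ^+ 2 by apply: sumr_ge0 => i _; rewrite exprn_ge0.
have M0 := proj2 Mp z.
rewrite -(ger0_norm M0) -ler_sqr ?nnegrE //.
have -> : quad_form M z = \sum_(p : 'I_n * 'I_n) M p.1 p.2 * (z p.1 * (z p.2)^*)^*.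
  rewrite -(pair_bigA _ (fun i j => M i j * (z i * (z j)^*)^*)) /=.
  apply: eq_bigr => i _; apply: eq_bigr => j _.
  by rewrite rmorphM /= conjCK; ring.
apply: le_trans (scalar_CS _ _) _; rewrite expr2.
have -> : \sum_(p : 'I_n * 'I_n) `|z p.1 * (z p.2)^*| ^+ 2 =
   (\sum_i `|z i| ^+ 2) * (\sum_i `|z i| ^+ 2).
  rewrite -(pair_bigA _ (fun i j => `|z i * (z j)^*| ^+ 2)) /= mulr_suml.
  apply: eq_bigr => i _; rewrite mulr_sumr; apply: eq_bigr => j _.
  by rewrite normrM norm_conjC exprMn.
by rewrite ler_piMl // mulr_ge0.
Qed.

End HilbertSchmidt.

(** * Construction of the balanced pair (S, T) by iteration *)

Section Balance.
Variables (R : realType) (H : hilbertType R) (n : nat) (X : 'M[H]_n).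
Implicit Types (S T : 'M[R[i]]_n).
Hypothesis gram_map_contr : forall T, hs_sqnorm (gram_map X T) <= hs_sqnorm T.

(** Since Phi^* is the Hilbert-Schmidt adjoint of Phi, G = Phi^*(S) satisfies |G|^2 = <S, Phi(G)> <=
    |S| |G|. *)
Lemma hs_sqnorm_gram_adj S : hs_sqnorm (gram_adj X S) <= hs_sqnorm S.
Proof.
set G := gram_adj X S; have [G0|G0] := eqVneq (hs_sqnorm G) 0; first by rewrite G0 hs_sqnorm_ge0.
have Gp : 0 < hs_sqnorm G by rewrite lt_def G0 hs_sqnorm_ge0.
rewrite -(ler_pM2r Gp) -expr2 -[X in X ^+ 2](ger0_norm (hs_sqnorm_ge0 G)).
apply: (@le_trans _ _ (hs_sqnorm S * hs_sqnorm (gram_map X G))); last first.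
  by rewrite ler_wpM2l ?hs_sqnorm_ge0.
apply: le_trans (scalar_CS _ _); rewrite le_eqVlt; apply/orP; left; apply/eqP.
congr (`|_| ^+ 2); rewrite /hs_sqnorm.
rewrite -(pair_bigA _ (fun i j => `|G i j| ^+ 2)) /=.
rewrite -(pair_bigA _ (fun i j => S i j * (gram_map X G i j)^*)) /=.
transitivity (\sum_l \sum_j \sum_k \sum_i
    dotp (X i j) (X k l) * S k i * (G l j)^*).
  apply: eq_bigr => l _; apply: eq_bigr => j _.
  rewrite normCK {1}/G mxE mulr_suml; apply: eq_bigr => k _.
  by rewrite mulr_suml.
under [LHS]eq_bigr do rewrite exchange_big /=.
rewrite [LHS]exchange_big; apply: eq_bigr => k _ /=.
under [LHS]eq_bigr do rewrite exchange_big /=.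
rewrite [LHS]exchange_big; apply: eq_bigr => i _ /=.
rewrite !mxE rmorph_sum mulr_sumr exchange_big /=; apply: eq_bigr => j _.
rewrite rmorph_sum mulr_sumr /=; apply: eq_bigr => l _.
by rewrite !mxE rmorphM /= -dotp_conj; ring.
Qed.

Lemma balanced_pair (c : R[i]) : 1 < c -> exists S T,
  [/\ psdmx (S - 1%:M), psdmx (T - 1%:M),
      psdmx (c *: T - gram_adj X S) & psdmx (c *: S - gram_map X T)].
Proof.
move=> c1; have c0 : 0 < c by exact: lt_trans c1.
have q0 : 0 <= c^-1 by rewrite invr_ge0 ltW.
have q1 : c^-1 <= 1 by rewrite invf_le1 // ltW.
have psd0 : psdmx (0 : 'M[R[i]]_n).
  by rewrite -(scale0r 1%:M); apply: psdmxZ (psdmx1 _ _).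
(* [S], [T] are the N-th iterates, and [F], [E] their increments to the next ones. The increments
   are positive and decay geometrically, so a finite stage suffices and no limit is taken. *)
have step N : exists S T E F,
  [/\ psdmx (S - 1%:M), psdmx (T - 1%:M), psdmx E, psdmx F &
   [/\ c^-1 *: gram_adj X S = T - 1%:M + E, c^-1 *: gram_map X T = S - 1%:M + F,
   hs_sqnorm E <= n%:R * c^-1 ^+ N & hs_sqnorm F <= n%:R * c^-1 ^+ N]].
  (* Scaling by 1/c multiplies the squared norm by c^-2, here weakened to c^-1. *)
  have shrink (M K : 'M[R[i]]_n) d : hs_sqnorm M <= hs_sqnorm K -> hs_sqnorm K <= d ->
      hs_sqnorm (c^-1 *: M) <= d * c^-1.
    move=> MK Kd; rewrite hs_sqnormZ ger0_norm // [d * _]mulrC.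
    apply: ler_pM; rewrite ?exprn_ge0 ?hs_sqnorm_ge0 //; last exact: le_trans Kd.
    by rewrite expr2 ler_piMl.
  elim: N => [|N [S [T [E [F [Sp Tp Ep Fp [SE TF E1 F1]]]]]]].
    exists 1%:M, 1%:M, (c^-1 *: gram_adj X 1%:M), (c^-1 *: gram_map X 1%:M).
    have le1 (M : 'M[R[i]]_n) : hs_sqnorm M <= hs_sqnorm (1%:M : 'M[R[i]]_n) ->
        hs_sqnorm (c^-1 *: M) <= n%:R * c^-1 ^+ 0.
      move=> M1; apply: (@le_trans _ _ (n%:R * c^-1)).
        by apply: shrink M1 _; rewrite hs_sqnorm_1.
      by rewrite expr0 ler_wpM2l // ler0n.
    rewrite !subrr !add0r; split; [exact: psd0 | exact: psd0 | | |].
    - exact: psdmxZ q0 (psdmx_gram_adj X (psdmx1 _ n)).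
    - exact: psdmxZ q0 (psdmx_gram_map X (psdmx1 _ n)).
    split; [by [] | by [] | |]; apply: le1.
    + exact: hs_sqnorm_gram_adj.
    + exact: gram_map_contr.
  exists (S + F), (T + E), (c^-1 *: gram_adj X F), (c^-1 *: gram_map X E).
  split.
  - by rewrite addrAC; exact: psdmxD Sp Fp.
  - by rewrite addrAC; exact: psdmxD Tp Ep.
  - exact: psdmxZ q0 (psdmx_gram_adj X Fp).
  - exact: psdmxZ q0 (psdmx_gram_map X Ep).
  split.
  - by rewrite gram_adjD scalerDr SE [T + E - _]addrAC.
  - by rewrite gram_mapD scalerDr TF [S + F - _]addrAC.
  - by rewrite exprSr mulrA; apply: shrink (hs_sqnorm_gram_adj _) F1.
  - by rewrite exprSr mulrA; apply: shrink (gram_map_contr _) E1.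
(* Bernoulli's inequality for c = 1 + e and the Archimedean property give such an N; the increments
   then have squared norm at most 1. *)
have [N cN] : exists N, n%:R <= c ^+ N.
  have : 0 < c - 1 by rewrite subr_gt0.
  move=> /complex_gt0[e e0 ce].
  have ne : 0 <= n%:R / e by rewrite divr_ge0 // ltW.
  pose N := Num.bound (n%:R / e); exists N.
  have bern k : 1 + k%:R * (c - 1) <= c ^+ k.
    elim: k => [|k IH]; first by rewrite mul0r addr0 expr0.
    rewrite exprSr; apply: le_trans (ler_wpM2r (ltW c0) IH); rewrite -subr_ge0.
    have -> : (1 + k%:R * (c - 1)) * c - (1 + k.+1%:R * (c - 1)) = k%:R * (c - 1) ^+ 2.
      by rewrite -natr1; ring.
    by rewrite mulr_ge0 ?ler0n // exprn_ge0 // subr_ge0 ltW.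
  apply: le_trans (bern N); rewrite ce.
  have := archi_boundP ne; rewrite ltr_pdivrMr // -/N => /ltW.
  rewrite -lecR rmorphM /= !rmorph_nat => /le_trans; apply.
  by rewrite lerDr.
have [S [T [E [F [Sp Tp Ep Fp [SE TF E1 F1]]]]]] := step N.
exists S, T.
have cN1 : n%:R * c^-1 ^+ N <= 1.
  by rewrite exprVn ler_pdivrMr ?exprn_gt0 // mul1r.
have scal (U W : 'M[R[i]]_n) : c^-1 *: U = W -> U = c *: W.
  by move=> <-; rewrite scalerA mulfV ?scale1r // gt_eqF.
(* This gives c T - Phi^*(S) = c (1 - E), which is positive once E has Hilbert-Schmidt norm at most
   1. *)
have fin (K W : 'M[R[i]]_n) : c *: W - c *: (W - 1%:M + K) = c *: (1%:M - K).
  by rewrite -scalerBr opprD opprB addrA addrCA subrr addr0.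
split; [exact: Sp | exact: Tp | |].
- rewrite (scal _ _ SE) fin; apply: psdmxZ (ltW c0) (psdmx_subr1 Ep _).
  exact: le_trans E1 cN1.
- rewrite (scal _ _ TF) fin; apply: psdmxZ (ltW c0) (psdmx_subr1 Fp _).
  exact: le_trans F1 cN1.
Qed.

End Balance.

(** * The Sylvester equation and the splitting X = A + B *)

Lemma amgm_le (C : numClosedFieldType) (s t l c : C) :
  0 <= s -> 0 < t -> 0 <= l -> 0 <= c -> (s + l * t) ^+ 2 <= c * t * s ->
  l <= c / 4.
Proof.
move=> s0 t0 l0 c0 h; rewrite ler_pdivlMr ?ltr0n //.
have lt0 : 0 <= l * t by rewrite mulr_ge0 // ltW.
(* If s = 0 the hypothesis forces l = 0. Otherwise (s + l t)^2 >= 4 l t s, and t s can be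
   cancelled. *)
have [se|sn] := eqVneq s 0.
  move: h; rewrite se add0r mulr0 => h.
  have /eqP : (l * t) ^+ 2 = 0 by apply/eqP; rewrite eq_le h exprn_ge0.
  by rewrite expf_eq0 /= mulf_eq0 (gt_eqF t0) orbF => /eqP ->; rewrite mul0r.
have sp : 0 < s by rewrite lt_def sn.
have ts : 0 < t * s by rewrite mulr_gt0.
rewrite -(ler_pM2r ts) mulrA (mulrA c); apply: le_trans h; rewrite -subr_ge0.
have -> : (s + l * t) ^+ 2 - l * 4 * t * s = (s - l * t) ^+ 2 by ring.
by rewrite -real_normK ?exprn_ge0 // rpredB // ger0_real.
Qed.

Section Sylvester.
Variables (R : realType) (H : hilbertType R) (n : nat).
Implicit Types (X A W : 'M[H]_n) (S T : 'M[R[i]]_n).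

Definition sylvester S T A W : Prop := forall i j,
  \sum_p S i p *: A p j + \sum_q T q j *: A i q = W i j.

(** The Hilbert-Schmidt inner product of the equation with [Y] is <S Y, Y> + <Y T, Y>. The first
    term is nonnegative and the second is at least |Y|^2 because T >= 1. *)
Lemma sylvester_inj S T (Y : 'M[R[i]]_n) : psdmx S -> psdmx (T - 1%:M) ->
  S *m Y + Y *m T = 0 -> Y = 0.
Proof.
move=> [_ S0] [_ T1] Y0.
have Tq z : \sum_i `|z i| ^+ 2 <= quad_form T z.
  by have := T1 z; rewrite quad_formB quad_form1 subr_ge0.
have sum0 : \sum_j quad_form S (Y^~ j) +
    \sum_i quad_form T (fun j => (Y i j)^*) = 0.
  transitivity (\sum_i \sum_j (S *m Y + Y *m T) i j * (Y i j)^*); last first.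
    by rewrite Y0; apply: big1 => i _; apply: big1 => j _; rewrite mxE mul0r.
  under [RHS]eq_bigr do under eq_bigr do rewrite !mxE mulrDl.
  under [RHS]eq_bigr do rewrite big_split /=.
  rewrite [RHS]big_split; congr (_ + _).
    rewrite [RHS]exchange_big; apply: eq_bigr => j _; apply: eq_bigr => i _.
    by rewrite mulr_suml.
  apply: eq_bigr => i _; rewrite /quad_form exchange_big; apply: eq_bigr => j _.
  by rewrite mulr_suml; apply: eq_bigr => q _; rewrite conjCK; ring.
have Ys : \sum_i \sum_j `|(Y i j)^*| ^+ 2 <= 0.
  rewrite -[leRHS]sum0; apply: ler_wpDl; first by apply: sumr_ge0 => j _.
  by apply: ler_sum => i _.
have nn i j : 0 <= `|(Y i j)^*| ^+ 2 by rewrite exprn_ge0.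
have ns i : 0 <= \sum_j `|(Y i j)^*| ^+ 2 by apply: sumr_ge0.
have /eqP : \sum_i \sum_j `|(Y i j)^*| ^+ 2 = 0.
  by apply/eqP; rewrite eq_le Ys sumr_ge0.
rewrite psumr_eq0 // => /allP Yi; apply/matrixP => i j.
have /eqP := eqP (Yi i (mem_index_enum _)).
rewrite psumr_eq0 // => /allP/(_ j (mem_index_enum _)).
by rewrite expf_eq0 /= normr_eq0 conjC_eq0 mxE => /eqP.
Qed.

(** The scalar operator Y |-> S Y + Y T is injective, hence invertible in finite dimension. Its
    solutions for the matrix units, weighted by the entries of [W], give a solution with entries in
    [H], which may be infinite-dimensional. *)
Lemma sylvester_solve S T W : psdmx S -> psdmx (T - 1%:M) ->
  exists A, sylvester S T A W.
Proof.
move=> Sp Tp.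
pose L : 'End('M[R[i]]_n) := (linfun (mulmx S) + linfun (mulmxr T))%VF.
have LE Y : L Y = S *m Y + Y *m T by rewrite lfunE /= !lfunE.
have L0 : lker L == 0%VS.
  apply/eqP/vspaceP => Y; rewrite memv_ker memv0 LE.
  apply/eqP/eqP => [/(sylvester_inj Sp Tp)//|->].
  by rewrite mulmx0 mul0mx addr0.
pose k p q := (L^-1)%VF (delta_mx p q).
have kE p q i j : \sum_p' S i p' * k p q p' j + \sum_q' T q' j * k p q i q' =
    (i == p)%:R * (j == q)%:R.
  have /matrixP/(_ i j) := LE (k p q).
  rewrite /k lker0_lfunVK // !mxE -natrM mulnb => ->; congr (_ + _).
  by apply: eq_bigr => q' _; rewrite mulrC.
exists (\matrix_(i, j) \sum_p \sum_q k p q i j *: W p q) => i j.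
transitivity (\sum_p \sum_q ((i == p)%:R * (j == q)%:R) *: W p q); last first.
  rewrite (bigD1 i) //= (bigD1 j) //= !eqxx mulr1 scale1r.
  rewrite big1 => [|q qj]; last by rewrite eq_sym (negPf qj) mulr0 scale0r.
  rewrite big1 ?addr0 // => p pi; apply: big1 => q _.
  by rewrite eq_sym (negPf pi) mul0r scale0r.
under [RHS]eq_bigr do under eq_bigr do rewrite -kE scalerDl !scaler_suml.
under [RHS]eq_bigr do rewrite big_split /=.
rewrite [RHS]big_split; congr (_ + _).
  under [RHS]eq_bigr do rewrite exchange_big /=.
  rewrite [RHS]exchange_big; apply: eq_bigr => p' _.
  rewrite mxE scaler_sumr; apply: eq_bigr => p _; rewrite scaler_sumr.
  by apply: eq_bigr => q _; rewrite scalerA.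
under [RHS]eq_bigr do rewrite exchange_big /=.
rewrite [RHS]exchange_big; apply: eq_bigr => q' _.
rewrite mxE scaler_sumr; apply: eq_bigr => p _; rewrite scaler_sumr.
by apply: eq_bigr => q _; rewrite scalerA.
Qed.

(** The number [b] bounds the squared norm of [X] as a column operator into H^n. For [ell2] the same
    bound on the transpose controls the row norm. *)
Definition col_bounded (b : R[i]) X : Prop := forall z,
  \sum_i `|vapply X z i| ^+ 2 <= b * \sum_j `|z j| ^+ 2.

(** The squared norm of [A] is the top eigenvalue of A^* A, which is [gram_adj A 1%:M]. *)
Lemma col_bounded_eigen b A :
  (forall l z, \sum_j `|z j| ^+ 2 = 1 -> 0 <= l ->
     (forall q, \sum_j gram_adj A 1%:M q j * z j = l * z q) -> l <= b) ->
  col_bounded b A.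
Proof.
move=> Ab; have [Gh G0] := psdmx_gram_adj A (psdmx1 _ n).
have [P [d [Pr Pc Gd]]] := hermitian_diag Gh.
have db k : d k <= b.
  have Gk q : \sum_j gram_adj A 1%:M q j * P k j = d k * P k q.
    under eq_bigr do rewrite Gd mulr_suml.
    rewrite exchange_big (bigD1 k) //= [X in _ + X]big1 ?addr0 => [|l lk].
      transitivity (d k * P k q * \sum_j P k j * (P k j)^*).
        by rewrite mulr_sumr; apply: eq_bigr => j _; ring.
      by rewrite Pr eqxx mulr1.
    transitivity (d l * P l q * \sum_j P k j * (P l j)^*).
      by rewrite mulr_sumr; apply: eq_bigr => j _; ring.
    by rewrite Pr eq_sym (negPf lk) mulr0.
  have P1 : \sum_j `|P k j| ^+ 2 = 1.
    transitivity (\sum_j P k j * (P k j)^*); last by rewrite Pr eqxx.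
    by apply: eq_bigr => j _; rewrite normCK.
  apply: (Ab (d k) (P k) P1 _ Gk); have := G0 (P k); congr (0 <= _).
  transitivity (d k * \sum_j `|P k j| ^+ 2); last by rewrite P1 mulr1.
  rewrite mulr_sumr; apply: eq_bigr => i _.
  by rewrite -mulr_suml Gk normCK mulrA.
move=> z; have -> : \sum_i `|vapply A z i| ^+ 2 = quad_form (gram_adj A 1%:M) z.
  by rewrite quad_form_gram_adj gform1; apply: eq_bigr => i _; rewrite dotp_norm.
(* Parseval: the identity has all eigenvalues 1 in the basis [P]. *)
have -> : \sum_j `|z j| ^+ 2 = \sum_k `|\sum_j z j * (P k j)^*| ^+ 2.
  rewrite -quad_form1 (quad_form_diag (P := P) (d := fun=> 1)).
    by apply: eq_bigr => k _; rewrite mul1r.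
  by move=> i j; rewrite mxE -Pc; apply: eq_bigr => k _; rewrite mul1r.
rewrite (quad_form_diag Gd) mulr_sumr; apply: ler_sum => k _.
by rewrite ler_wpM2r // exprn_ge0.
Qed.

(* Pair S A + A T = S X with a top singular pair (z, A z) of A: the left side
   becomes <S Az, Az> + l <T z, z>, and by Cauchy-Schwarz the right side is at
   most the geometric mean of <S Az, Az> and c <T z, z>. *)
Lemma sylvester_col_bounded (c : R[i]) S T X A : 0 <= c ->
  psdmx S -> psdmx (T - 1%:M) -> psdmx (c *: T - gram_adj X S) ->
  sylvester S T A (\matrix_(i, j) \sum_p S i p *: X p j) ->
  col_bounded (c / 4) A.
Proof.
move=> c0 Sp [_ T1] [_ TX] SA; apply: col_bounded_eigen => l z z1 l0 Gz.
have Gh := proj1 (psdmx_gram_adj A (psdmx1 _ n)).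
set e := vapply A z.
have t0 : 0 < quad_form T z.
  apply: (@lt_le_trans _ _ 1) => //.
  by have := T1 z; rewrite quad_formB quad_form1 z1 subr_ge0.
(* Coordinate q of A^* A z = l z, conjugated. *)
have AG q : \sum_i dotp (A i q) (e i) = l * (z q)^*.
  transitivity (\sum_j (z j)^* * gram_adj A 1%:M j q).
    under eq_bigr do rewrite dotp_sumr.
    rewrite exchange_big; apply: eq_bigr => j _ /=.
    rewrite mxE mulr_sumr; apply: eq_bigr => i _.
    rewrite dotpZr (bigD1 i) //= big1 ?addr0 => [|p pi]; rewrite mxE.
      by rewrite eqxx mulr1.
    by rewrite eq_sym (negPf pi) mulr0.
  rewrite -(geC0_conj l0) -rmorphM /= -Gz rmorph_sum; apply: eq_bigr => j _.
  by rewrite rmorphM /= -Gh mulrC.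
have key : gform S (vapply X z) e = gform S e e + l * quad_form T z.
  have gE u : gform S u e = \sum_i dotp (\sum_p S i p *: u p) (e i).
    apply: eq_bigr => i _; rewrite dotp_suml; apply: eq_bigr => p _.
    by rewrite dotpZl.
  have -> : l * quad_form T z =
      \sum_i dotp (\sum_j z j *: \sum_q T q j *: A i q) (e i).
    under [RHS]eq_bigr do rewrite dotp_suml.
    rewrite exchange_big /= /quad_form exchange_big mulr_sumr.
    apply: eq_bigr => j _; rewrite mulr_sumr.
    under [RHS]eq_bigr do rewrite dotpZl dotp_suml mulr_sumr.
    rewrite exchange_big; apply: eq_bigr => q _ /=.
    rewrite (_ : l * _ = z j * T q j * (l * (z q)^*)); last by ring.
    by rewrite -AG mulr_sumr; apply: eq_bigr => i _; rewrite dotpZl mulrA.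
  rewrite !gE -big_split; apply: eq_bigr => i _ /=; rewrite -dotpDl.
  congr dotp.
  transitivity (\sum_j z j *: \sum_p S i p *: X p j).
    under eq_bigr do rewrite scaler_sumr.
    rewrite exchange_big; apply: eq_bigr => j _; rewrite scaler_sumr.
    by apply: eq_bigr => p _; rewrite !scalerA mulrC.
  have SAi j : \sum_p S i p *: X p j =
      \sum_p S i p *: A p j + \sum_q T q j *: A i q by rewrite SA mxE.
  under [LHS]eq_bigr do rewrite SAi scalerDr.
  rewrite big_split; congr (_ + _).
  under [RHS]eq_bigr do rewrite scaler_sumr.
  rewrite [RHS]exchange_big; apply: eq_bigr => j _; rewrite scaler_sumr.
  by apply: eq_bigr => p _; rewrite !scalerA mulrC.
have s0 : 0 <= gform S e e by exact: gform_ge0.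
apply: (amgm_le s0 t0 l0 c0).
have st0 : 0 <= gform S e e + l * quad_form T z.
  by rewrite addr_ge0 // mulr_ge0 // ltW.
rewrite -{1}(ger0_norm st0) -key; apply: le_trans (gform_CS _ _ Sp) _.
apply: ler_wpM2r => //; have := TX z.
by rewrite quad_formB quad_formZ quad_form_gram_adj subr_ge0.
Qed.

End Sylvester.

Section Decomposition.
Variables (R : realType) (H : hilbertType R) (n : nat) (X : 'M[H]_n).

Lemma gram_contraction_split (c : R[i]) :
  (forall T, hs_sqnorm (gram_map X T) <= hs_sqnorm T) -> 1 < c ->
  exists A B : 'M[H]_n,
    [/\ X = A + B, col_bounded (c / 4) A & col_bounded (c / 4) B^T].
Proof.
move=> Xc c1; have c0 : 0 <= c by apply: ltW (lt_trans _ c1).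
have [S [T [Sp Tp TX SX]]] := balanced_pair Xc c1.
have psd (M : 'M[R[i]]_n) : psdmx (M - 1%:M) -> psdmx M.
  by move=> /psdmxD/(_ (psdmx1 _ n)); rewrite subrK.
have tr1 (M : 'M[R[i]]_n) : psdmx (M - 1%:M) -> psdmx (M^T - 1%:M).
  by move/psdmx_tr; rewrite linearB /= trmx1.
have [A SA] := sylvester_solve (\matrix_(i, j) \sum_p S i p *: X p j) (psd _ Sp) Tp.
exists A, (X - A); split; first by rewrite addrC subrK.
  exact: sylvester_col_bounded (psd _ Sp) Tp TX SA.
have TX' : psdmx (c *: S^T - gram_adj X^T T^T).
  by have := psdmx_tr SX; rewrite linearB linearZ /= trmxK.
(* B = X - A solves S B + B T = X T. The transpose T^T B^T + B^T S^T = T^T X^T has the same shape,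
   with [T^T], [S^T], [X^T] in place of [S], [T], [X]. *)
apply: (sylvester_col_bounded c0 (psd _ (tr1 _ Tp)) (tr1 _ Sp) TX').
move=> j i; rewrite mxE.
have -> : \sum_p T^T j p *: (X - A)^T p i =
    \sum_p T p j *: X i p - \sum_p T p j *: A i p.
  by rewrite -sumrB; apply: eq_bigr => p _; rewrite !mxE scalerBr.
have -> : \sum_q S^T q i *: (X - A)^T j q =
    \sum_q T q j *: A i q.
  have -> : \sum_q S^T q i *: (X - A)^T j q =
      \sum_q S i q *: X q j - \sum_q S i q *: A q j.
    by rewrite -sumrB; apply: eq_bigr => q _; rewrite !mxE scalerBr.
  by have := SA i j; rewrite mxE => <-; rewrite addrC addKr.
by rewrite subrK; apply: eq_bigr => p _; rewrite !mxE.
Qed.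

End Decomposition.

(** * Pairing of column bounds with row bounds *)

Lemma ler_cancel_sqr (C : numDomainType) (p k : C) :
  0 <= p -> 0 <= k -> p ^+ 2 <= k * p -> p <= k.
Proof.
move=> p0 k0 h; have [->//|pn] := eqVneq p 0.
by rewrite -(@ler_pM2r _ p) -?expr2 // lt_def pn.
Qed.

Section Pairing.
Variables (R : realType) (H : hilbertType R).

(** The output o is paired with itself. Regrouping makes [Y] act on [v] and [X^T] act on o, so its
    square sum p satisfies p^2 <= (a |v|^2) (b p), and p is cancelled. *)
Lemma pairing_le (m n : nat) (Y : 'M[H]_m) (X : 'M[H]_n) (a b : R[i])
    (v : 'I_m -> 'I_n -> R[i]) :
  0 <= a -> 0 <= b -> col_bounded a Y -> col_bounded b X^T ->
  \sum_k \sum_i `|\sum_l \sum_j dotp (Y k l) (X i j) * v l j| ^+ 2 <=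
  a * b * \sum_l \sum_j `|v l j| ^+ 2.
Proof.
move=> a0 b0 Ya Xb; pose o k i := \sum_l \sum_j dotp (Y k l) (X i j) * v l j.
have nn I J (f : I -> J -> R[i]) (r : seq I) (s : seq J) :
    0 <= \sum_(i <- r) \sum_(j <- s) `|f i j| ^+ 2.
  by apply: sumr_ge0 => i _; apply: sumr_ge0 => j _; rewrite exprn_ge0.
set p := \sum_k \sum_i _; have p0 : 0 <= p by exact: nn.
apply: ler_cancel_sqr => //; first by rewrite !mulr_ge0 ?nn.
pose f (q : 'I_m * 'I_n) := vapply Y (v^~ q.2) q.1.
pose g (q : 'I_m * 'I_n) := vapply X^T (o q.1) q.2.
have pE : p = \sum_q dotp (f q) (g q).
  rewrite -(pair_bigA _ (fun k j => dotp (f (k, j)) (g (k, j)))) /=.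
  apply: eq_bigr => k _.
  under [RHS]eq_bigr do rewrite dotp_sumr.
  rewrite [RHS]exchange_big; apply: eq_bigr => i _ /=.
  rewrite -/(o k i) normCK mulrC {2}/o exchange_big mulr_sumr; apply: eq_bigr => j _ /=.
  rewrite dotp_suml mulr_sumr; apply: eq_bigr => l _.
  by rewrite mxE dotpZl dotpZr; ring.
rewrite -[p in leLHS](ger0_norm p0) pE; apply: le_trans (sum_CS _ _) _.
rewrite -pE [leRHS](_ : _ = (a * \sum_l \sum_j `|v l j| ^+ 2) * (b * p)); last by ring.
apply: ler_pM; do ?by apply: sumr_ge0 => q _; rewrite exprn_ge0.
- rewrite -(pair_bigA _ (fun k j => `|f (k, j)| ^+ 2)) exchange_big /=.
  rewrite [X in a * X]exchange_big mulr_sumr; apply: ler_sum => j _.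
  exact: (Ya (v^~ j)).
- rewrite -(pair_bigA _ (fun k j => `|g (k, j)| ^+ 2)) /= mulr_sumr.
  by apply: ler_sum => k _; exact: (Xb (o k)).
Qed.

(** Here the transpose of [Y] acts on the conjugate of the output and [X] on the conjugate of [v],
    so that the column bound falls on [X]. *)
Lemma pairing_le_tr (m n : nat) (Y : 'M[H]_m) (X : 'M[H]_n) (a b : R[i])
    (v : 'I_m -> 'I_n -> R[i]) :
  0 <= a -> 0 <= b -> col_bounded a Y^T -> col_bounded b X ->
  \sum_k \sum_i `|\sum_l \sum_j dotp (Y k l) (X i j) * v l j| ^+ 2 <=
  a * b * \sum_l \sum_j `|v l j| ^+ 2.
Proof.
move=> a0 b0 Ya Xb; pose o k i := \sum_l \sum_j dotp (Y k l) (X i j) * v l j.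
have nn I J (f : I -> J -> R[i]) (r : seq I) (s : seq J) :
    0 <= \sum_(i <- r) \sum_(j <- s) `|f i j| ^+ 2.
  by apply: sumr_ge0 => i _; apply: sumr_ge0 => j _; rewrite exprn_ge0.
set p := \sum_k \sum_i _; have p0 : 0 <= p by exact: nn.
apply: ler_cancel_sqr => //; first by rewrite !mulr_ge0 ?nn.
pose f (q : 'I_m * 'I_n) := vapply Y^T (fun k => (o k q.2)^*) q.1.
pose g (q : 'I_m * 'I_n) := vapply X (fun j => (v q.1 j)^*) q.2.
have pE : p = \sum_q dotp (f q) (g q).
  rewrite -(pair_bigA _ (fun l i => dotp (f (l, i)) (g (l, i)))) /=.
  rewrite [RHS]exchange_big /p [LHS]exchange_big. apply: eq_bigr => i _ /=.
  under [RHS]eq_bigr do rewrite dotp_suml.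
  rewrite [RHS]exchange_big; apply: eq_bigr => k _ /=.
  rewrite -/(o k i) normCK mulrC {2}/o mulr_sumr; apply: eq_bigr => l _ /=.
  rewrite dotp_sumr mulr_sumr; apply: eq_bigr => j _.
  by rewrite mxE dotpZl dotpZr conjCK; ring.
rewrite -[p in leLHS](ger0_norm p0) pE; apply: le_trans (sum_CS _ _) _.
rewrite -pE [leRHS](_ : _ = (a * p) * (b * \sum_l \sum_j `|v l j| ^+ 2)); last by ring.
apply: ler_pM; do ?by apply: sumr_ge0 => q _; rewrite exprn_ge0.
- rewrite -(pair_bigA _ (fun k j => `|f (k, j)| ^+ 2)) exchange_big /=.
  rewrite /p [X in a * X]exchange_big mulr_sumr; apply: ler_sum => j _.
  apply: le_trans (Ya (fun k => (o k j)^*)) _; rewrite ler_wpM2l //; apply: ler_sum => k _.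
  by rewrite norm_conjC.
- rewrite -(pair_bigA _ (fun k j => `|g (k, j)| ^+ 2)) /= mulr_sumr.
  apply: ler_sum => l _; apply: le_trans (Xb (fun j => (v l j)^*)) _.
  by rewrite ler_wpM2l //; apply: ler_sum => k _; rewrite norm_conjC.
Qed.

(** The map v |-> (sum_j <v_j, U_ij>)_i is the adjoint of the column operator of [U^T], so both have
    the same norm. *)
Lemma col_bounded_dualP (n : nat) (U : 'M[H]_n) (b : R[i]) : 0 <= b ->
  (forall v : 'I_n -> H, \sum_i `|\sum_j dotp (v j) (U i j)| ^+ 2 <=
     b * \sum_j `|v j| ^+ 2) <-> col_bounded b U^T.
Proof.
move=> b0; have nn (L : hilbertType R) (f : 'I_n -> L) : 0 <= \sum_i `|f i| ^+ 2.
  by apply: sumr_ge0 => i _; rewrite exprn_ge0.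
split=> [Ub z|Ub v].
  set v := vapply U^T z; set p := \sum_j `|v j| ^+ 2.
  have p0 : 0 <= p by exact: nn.
  have z0 := nn (cplx R) z.
  apply: ler_cancel_sqr => //; first by rewrite mulr_ge0.
  have pE : p = \sum_i (\sum_j dotp (v j) (U i j)) * (z i)^*.
    under [RHS]eq_bigr do rewrite mulr_suml.
    rewrite exchange_big; apply: eq_bigr => j _ /=.
    rewrite -dotp_norm {2}/v dotp_sumr; apply: eq_bigr => i _.
    by rewrite mxE dotpZr mulrC.
  rewrite -[p in leLHS](ger0_norm p0) pE; apply: le_trans (scalar_CS _ _) _.
  rewrite -pE mulrAC; apply: ler_wpM2r; first exact: z0.
  exact: Ub.
pose o i := \sum_j dotp (v j) (U i j); set p := \sum_i _.
have p0 : 0 <= p by exact: (nn (cplx R)).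
apply: ler_cancel_sqr => //; first by rewrite mulr_ge0 ?nn.
have pE : p = \sum_j dotp (v j) (vapply U^T o j).
  under [RHS]eq_bigr do rewrite dotp_sumr.
  rewrite exchange_big; apply: eq_bigr => i _ /=.
  rewrite -/(o i) normCK mulrC {2}/o mulr_sumr; apply: eq_bigr => j _.
  by rewrite mxE dotpZr.
rewrite -[p in leLHS](ger0_norm p0) pE; apply: le_trans (sum_CS _ _) _.
rewrite -pE mulrAC [leRHS]mulrC; by apply: ler_wpM2l.
Qed.

End Pairing.

(** * Matrix norms of C, R and M_n as quadratic inequalities *)

Section Norms.
Variable R : realType.

(** Squares suit the norm of [hsum], whose square is a sum of squares. From left to right, a nonzero
    [v] is rescaled to norm 1. *)
Lemma opnorm_leP (V W : normedModType R[i]) (f : V -> W) (M : R) :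
  (forall (a : R[i]) v, f (a *: v) = a *: f v) -> 0 <= M ->
  (opnorm f <= M%:E)%E <->
  forall v, `|f v| ^+ 2 <= (M ^+ 2)%:C%C * `|v| ^+ 2.
Proof.
move=> fZ M0; have -> : (forall v, `|f v| ^+ 2 <= (M ^+ 2)%:C%C * `|v| ^+ 2) <->
    forall v, rnorm (f v) <= M * rnorm v.
  by split=> h v; have := h v; rewrite -!rnormX_complex -rmorphM lecR -exprMn
    ler_sqr ?nnegrE ?mulr_ge0 ?rnorm_ge0.
split=> [fM v|fM]; last first.
  apply: ub_ereal_sup => _ [v /= v1 <-]; rewrite lee_fin.
  by apply: le_trans (fM v) _; rewrite ler_piMr.
have [v0|v0] := eqVneq (rnorm v) 0.
  have -> : v = 0 by apply/eqP; rewrite -normr_eq0 -rnormE v0.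
  by have := fZ 0 0; rewrite !scale0r => ->; rewrite /rnorm !normr0 mulr0.
have vp : 0 < rnorm v by rewrite lt_def v0 rnorm_ge0.
pose a : R := (rnorm v)^-1.
have aE (U : normedModType R[i]) (u : U) : rnorm (a%:C%C *: u) = a * rnorm u.
  have -> := rnormZ (a%:C%C : cplx R) u; congr (_ * _).
  apply: (@complexI R); rewrite rnormE [LHS]ger0_norm // ler0c.
  by rewrite invr_ge0 ltW.
have : ((rnorm (f (a%:C%C *: v)))%:E <= opnorm f)%E.
  apply: ereal_sup_ubound; exists (a%:C%C *: v) => //=.
  by rewrite aE mulVf.
by move=> /le_trans/(_ fM); rewrite lee_fin fZ aE mulrC ler_pdivrMr.
Qed.

Lemma colH_leP n (X : 'M[ell2 R]_n) (M : R) : 0 <= M ->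
  (mn_norm (colH R) X <= M%:E)%E <-> col_bounded (M ^+ 2)%:C%C X.
Proof.
move=> M0; rewrite /mn_norm /= opnorm_leP //; last first.
  move=> a v; apply/ffunP => i; rewrite !ffunE scaler_sumr.
  by apply: eq_bigr => j _; rewrite !mxE !ffunE /= scalerA.
split=> [h z|h v].
  have := h [ffun j => z j : cplx R]; rewrite !hsum_normE.
  under eq_bigr do rewrite ffunE.
  under [X in _ <= _ * X]eq_bigr do rewrite ffunE.
  congr (_ <= _); apply: eq_bigr => i _; congr (`|_| ^+ 2).
  by apply: eq_bigr => j _; rewrite mxE ffunE.
rewrite !hsum_normE; apply: le_trans (h (fun j => v j)).
rewrite le_eqVlt; apply/orP; left; apply/eqP.
apply: eq_bigr => i _; congr (`|_| ^+ 2).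
by rewrite ffunE; apply: eq_bigr => j _; rewrite mxE.
Qed.

Lemma ell2_conjZD (a : R[i]) (x y : ell2 R) :
  ell2_conj (a *: x + y) = a^* *: ell2_conj x + ell2_conj y.
Proof.
by apply/val_inj/funext => k; rewrite /= -[LHS]/((a * x k + y k)^*) rmorphD rmorphM.
Qed.

Lemma ell2_conj_norm (x : ell2 R) : `|ell2_conj x| = `|x|.
Proof.
suff : rnorm (ell2_conj x) ^+ 2 = rnorm x ^+ 2.
  move=> /eqP; rewrite eqrXn2 ?rnorm_ge0 // => /eqP h.
  by rewrite -!rnormE h.
rewrite !ell2_normE; congr (limn (series _)); apply/funext => k /=.
by congr (complex.Re _ ^+ 2); exact: norm_conjC.
Qed.

(** Coordinatewise conjugation is an antilinear isometry of [ell2], so conjugating the test vector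
    [z] trades one bound for the other. *)
Lemma col_bounded_conj n (X : 'M[ell2 R]_n) b :
  col_bounded b (map_mx (@ell2_conj R) X) <-> col_bounded b X.
Proof.
have conj0 : ell2_conj (0 : ell2 R) = 0.
  by apply/val_inj/funext => k; rewrite /= -[LHS]/((0 : R[i])^*) rmorph0.
have conjS (z : 'I_n -> R[i]) i : ell2_conj (vapply X z i) =
    vapply (map_mx (@ell2_conj R) X) (fun j => (z j)^*) i.
  have cD : {morph (@ell2_conj R) : x y / x + y}.
    by move=> x y; have := ell2_conjZD 1 x y; rewrite rmorph1 !scale1r.
  rewrite /vapply (big_morph _ cD conj0); apply: eq_bigr => j _.
  by have := ell2_conjZD (z j) (X i j) 0; rewrite conj0 !addr0 mxE.
have nz (z : 'I_n -> R[i]) : \sum_j `|(z j)^*| ^+ 2 = \sum_j `|z j| ^+ 2.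
  by apply: eq_bigr => j _; rewrite norm_conjC.
split=> h z; have := h (fun j => (z j)^*); rewrite nz; congr (_ <= _).
  by apply: eq_bigr => i _; rewrite -conjS ell2_conj_norm.
apply: eq_bigr => i _; rewrite -ell2_conj_norm conjS.
have -> // : (fun j => ((z j)^*)^*) = z by apply/funext => j; rewrite conjCK.
Qed.

(** As [row_fun x y] is the inner product of [y] with the conjugate of [x], the block row operator
    is the adjoint of the column operator of the transpose with conjugated entries. *)
Lemma rowH_leP n (X : 'M[ell2 R]_n) (M : R) : 0 <= M ->
  (mn_norm (rowH R) X <= M%:E)%E <-> col_bounded (M ^+ 2)%:C%C X^T.
Proof.
move=> M0; have rE (x y : ell2 R) : row_fun x y = dotp y (ell2_conj x) := row_funE x y.
rewrite -col_bounded_conj -map_trmx -col_bounded_dualP; last first.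
  by rewrite ler0c exprn_ge0.
rewrite /mn_norm /= opnorm_leP //; last first.
  move=> a v; apply/ffunP => i; rewrite !ffunE scaler_sumr.
  by apply: eq_bigr => j _; rewrite !mxE !ffunE /= !rE dotpZl.
split=> [h v|h v].
  have := h [ffun j => v j]; rewrite !hsum_normE.
  under [X in _ <= _ * X]eq_bigr do rewrite ffunE.
  congr (_ <= _); apply: eq_bigr => i _; congr (`|_| ^+ 2).
  by rewrite ffunE; apply: eq_bigr => j _; rewrite !mxE ffunE /= rE.
rewrite !hsum_normE; apply: le_trans (h (fun j => v j)).
rewrite le_eqVlt; apply/orP; left; apply/eqP.
apply: eq_bigr => i _; congr (`|_| ^+ 2).
by rewrite ffunE; apply: eq_bigr => j _; rewrite !mxE /= rE.
Qed.

Lemma mxB_leP m n (Z : 'M['M[R[i]]_n]_m) (M : R) : 0 <= M ->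
  (mn_norm (mxB R n) Z <= M%:E)%E <->
  forall v : 'I_m -> 'I_n -> R[i],
    \sum_k \sum_i `|\sum_l \sum_j Z k l i j * v l j| ^+ 2 <=
    (M ^+ 2)%:C%C * \sum_l \sum_j `|v l j| ^+ 2.
Proof.
move=> M0; rewrite /mn_norm /= opnorm_leP //; last first.
  move=> a v; apply/ffunP => k; rewrite !ffunE scaler_sumr.
  apply: eq_bigr => l _; apply/ffunP => i; rewrite !ffunE scaler_sumr.
  by apply: eq_bigr => j _; rewrite !ffunE !scalerA mulrC.
have nrm (u : hsum m (hsum n (cplx R))) :
    `|u| ^+ 2 = \sum_k \sum_i `|u k i| ^+ 2.
  by rewrite hsum_normE; apply: eq_bigr => k _; rewrite hsum_normE.
have out (v : hsum m (hsum n (cplx R))) k i :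
    block_op (fun k l => block_op (fun i j (z : cplx R) => (Z k l i j *: z) : cplx R)) v k i =
    \sum_l \sum_j Z k l i j * v l j.
  rewrite ffunE sum_ffunE; apply: eq_bigr => l _; rewrite ffunE.
  by apply: eq_bigr => j _.
split=> [h v|h v].
  have := h [ffun l => [ffun j => v l j : cplx R]]; rewrite !nrm.
  under [X in _ <= _ * X]eq_bigr do under eq_bigr do rewrite !ffunE.
  congr (_ <= _); apply: eq_bigr => k _; apply: eq_bigr => i _.
  rewrite out; congr (`|_| ^+ 2); apply: eq_bigr => l _.
  by apply: eq_bigr => j _; rewrite !ffunE.
rewrite !nrm; apply: le_trans (h (fun l j => v l j)).
rewrite le_eqVlt; apply/orP; left; apply/eqP.
by apply: eq_bigr => k _; apply: eq_bigr => i _; rewrite out.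
Qed.

End Norms.

(** * Norms in the dual and in the 1-sum *)

Section MatrixNorms.
Variable R : realType.

Lemma dual_apply (E : mnspace R) m n (f : 'M[functional E]_m) (A : 'M[E]_n) :
  (mn_norm (dual E) f <= 1)%E -> (mn_norm E A <= 1)%E ->
  (mn_norm (mxB R m) (map_mx (fun x => \matrix_(k, l) (f k l x : R[i])) A) <= 1)%E.
Proof.
by move=> f1 A1; apply: le_trans f1; apply: ereal_sup_ubound; exists n, A.
Qed.

(** Completely bounded norms are suprema over unit balls, and [mnspace] assumes no homogeneity. A
    bound r on [A] is therefore expressed by A / r lying in the unit ball, and linearity of the
    functionals restores the factor. *)
Lemma dual_apply_scaled (E : mnspace R) m n (f : 'M[functional E]_m)
    (A : 'M[E]_n) (r : R) (v : 'I_m -> 'I_n -> R[i]) : 0 < r ->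
  (mn_norm (dual E) f <= 1)%E ->
  (mn_norm E (map_mx ( *:%R (r^-1)%:C%C) A) <= 1)%E ->
  \sum_k \sum_i `|\sum_l \sum_j (f k l (A i j) : R[i]) * v l j| ^+ 2 <=
  (r ^+ 2)%:C%C * \sum_l \sum_j `|v l j| ^+ 2.
Proof.
move=> r0 f1 A1; have := dual_apply f1 A1; rewrite mxB_leP //.
(* The block matrix is indexed first by positions in [A], then by positions in [f], opposite to the
   order in the statement. *)
move=> /(_ (fun j l => v l j)).
have fZ k l x : (f k l x : R[i]) = r%:C%C * f k l ((r^-1)%:C%C *: x).
  have fl a y z : f k l (a *: y + z) = a *: f k l y + f k l z.
    by have /asboolP[fl _] := valP (f k l); exact: fl.
  have f0 : f k l 0 = 0.
    by have := fl (-1) 0 0; rewrite scaler0 addr0 scaleN1r addNr.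
  have := fl (r^-1)%:C%C x 0; rewrite f0 !addr0 /= => ->.
  rewrite -[_ *: _]/((r^-1)%:C%C * (f k l x : R[i])) mulrA -rmorphM /=.
  by rewrite mulfV ?gt_eqF // rmorph1 mul1r.
rewrite expr1n mul1r => h.
have -> : \sum_k \sum_i `|\sum_l \sum_j (f k l (A i j) : R[i]) * v l j| ^+ 2 =
    (r ^+ 2)%:C%C * \sum_i \sum_k
      `|\sum_j \sum_l (f k l ((r^-1)%:C%C *: A i j) : R[i]) * v l j| ^+ 2.
  rewrite exchange_big mulr_sumr; apply: eq_bigr => i _ /=.
  rewrite mulr_sumr; apply: eq_bigr => k _.
  have -> : (r ^+ 2)%:C%C = `|r%:C%C : R[i]| ^+ 2.
    by rewrite ger0_norm ?ler0c ?ltW // rmorphXn.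
  rewrite -exprMn -normrM; congr (`|_| ^+ 2).
  rewrite exchange_big mulr_sumr; apply: eq_bigr => j _ /=.
  by rewrite mulr_sumr; apply: eq_bigr => l _; rewrite fZ mulrA.
apply: ler_wpM2l; first by rewrite ler0c exprn_ge0 // ltW.
rewrite [leRHS]exchange_big /=.
move: h; congr (_ <= _); apply: eq_bigr => i _; apply: eq_bigr => k _.
congr (`|_| ^+ 2); apply: eq_bigr => j _; apply: eq_bigr => l _.
by rewrite !mxE.
Qed.

(** Both parts have the same bound, so |x + y|^2 <= 2 |x|^2 + 2 |y|^2 yields the constant of the
    triangle inequality, 4 r^2 = (2 r)^2. *)
Lemma sum_split_le (I J : finType) (f g : I -> J -> R[i]) (r : R) (N : R[i]) :
  \sum_k \sum_i `|f k i| ^+ 2 <= (r ^+ 2)%:C%C * N ->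
  \sum_k \sum_i `|g k i| ^+ 2 <= (r ^+ 2)%:C%C * N ->
  \sum_k \sum_i `|f k i + g k i| ^+ 2 <= ((2 * r) ^+ 2)%:C%C * N.
Proof.
move=> hf hg.
have par (x y : R[i]) : `|x + y| ^+ 2 <= 2 * `|x| ^+ 2 + 2 * `|y| ^+ 2.
  rewrite -subr_ge0.
  have -> : 2 * `|x| ^+ 2 + 2 * `|y| ^+ 2 - `|x + y| ^+ 2 = `|x - y| ^+ 2.
    by rewrite !normCK rmorphB rmorphD /=; ring.
  by rewrite exprn_ge0.
apply: (@le_trans _ _ (2 * \sum_k \sum_i `|f k i| ^+ 2
    + 2 * \sum_k \sum_i `|g k i| ^+ 2)).
  rewrite !mulr_sumr -big_split; apply: ler_sum => k _ /=.
  rewrite !mulr_sumr -big_split; apply: ler_sum => i _ /=.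
  exact: par.
rewrite exprMn rmorphM /= -mulrA; set M := _ * N in hf hg *.
have -> : (2 ^+ 2)%:C%C * M = 2 * M + 2 * M :> R[i].
  by rewrite rmorphXn /= rmorph_nat; ring.
by apply: lerD; apply: ler_wpM2l.
Qed.

Lemma sum_one_le (E F : mnspace R) n (Y : 'M[sum_one E F]_n) (r : R) :
  0 < r ->
  (mn_norm E (map_mx ( *:%R (r^-1)%:C%C) (map_mx fst Y)) <= 1)%E ->
  (mn_norm F (map_mx ( *:%R (r^-1)%:C%C) (map_mx snd Y)) <= 1)%E ->
  (mn_norm (sum_one E F) Y <= (2 * r)%:E)%E.
Proof.
move=> r0 Y1 Y2; apply: ub_ereal_sup => _ [m [fg fg1 ->]].
move: fg1; rewrite ge_max => /andP[f1 g1].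
rewrite mxB_leP ?mulr_ge0 ?(ltW r0) // => v.
have hf := dual_apply_scaled v r0 f1 Y1.
have hg := dual_apply_scaled v r0 g1 Y2.
apply: le_trans (sum_split_le hf hg).
rewrite le_eqVlt; apply/orP; left; apply/eqP.
apply: eq_bigr => k _; apply: eq_bigr => i _; congr (`|_| ^+ 2).
rewrite -big_split; apply: eq_bigr => l _.
by rewrite -big_split; apply: eq_bigr => j _; rewrite !mxE mulrDl.
Qed.

Lemma col_bounded_scale (H : hilbertType R) n (A : 'M[H]_n) (r : R) : 0 < r ->
  col_bounded (r ^+ 2)%:C%C A ->
  col_bounded 1 (map_mx ( *:%R (r^-1)%:C%C) A).
Proof.
move=> r0 Ar z; rewrite mul1r.
have -> : \sum_i `|vapply (map_mx ( *:%R (r^-1)%:C%C) A) z i| ^+ 2 =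
    ((r ^+ 2)%:C%C)^-1 * \sum_i `|vapply A z i| ^+ 2.
  rewrite mulr_sumr; apply: eq_bigr => i _.
  have -> : vapply (map_mx ( *:%R (r^-1)%:C%C) A) z i = (r^-1)%:C%C *: vapply A z i.
    rewrite scaler_sumr; apply: eq_bigr => j _.
    by rewrite mxE !scalerA mulrC.
  rewrite normrZ exprMn ger0_norm ?ler0c ?invr_ge0 ?ltW //.
  by rewrite -rmorphXn -fmorphV /= exprVn.
by rewrite ler_pdivrMl ?ltcR ?exprn_gt0.
Qed.

End MatrixNorms.

(** * Splitting a matrix over OH into a column part and a row part *)

Section OHSplit.
Variables (R : realType) (OH : OHspace R) (n : nat).
Implicit Types (X : 'M[os_mn OH]_n).
Let coord X := map_mx (oh_coord OH) X : 'M[ell2 R]_n.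

(** By self-duality the matrix of functionals <., X_ij> has norm at most 1 over the dual; it is
    evaluated on [Y]. *)
Lemma OH_dual_pairing m X (Y : 'M[os_mn OH]_m) :
  (mn_norm (os_mn OH) X <= 1)%E -> (mn_norm (os_mn OH) Y <= 1)%E ->
  forall v : 'I_m -> 'I_n -> R[i],
    \sum_k \sum_i `|\sum_l \sum_j
      dotp (oh_coord OH (Y k l)) (coord X i j) * v l j| ^+ 2 <=
    \sum_l \sum_j `|v l j| ^+ 2.
Proof.
rewrite -(oh_selfdual X) => X1 Y1 v.
have := dual_apply X1 Y1; rewrite mxB_leP // => /(_ v).
rewrite expr1n mul1r; congr (_ <= _).
apply: eq_bigr => k _; apply: eq_bigr => i _; congr (`|_| ^+ 2).
apply: eq_bigr => l _; apply: eq_bigr => j _.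
by rewrite !mxE.
Qed.

Lemma OH_split X (e : R) : (mn_norm (os_mn OH) X <= 1)%E -> 0 < e ->
  exists A B : 'M[ell2 R]_n, [/\ coord X = A + B,
    col_bounded (((1 + e) / 2) ^+ 2)%:C%C A &
    col_bounded (((1 + e) / 2) ^+ 2)%:C%C B^T].
Proof.
move=> X1 e0.
(* With c = (1 + e)^2, c / 4 is the square of (1 + e) / 2. The contraction hypothesis is the pairing
   of [X] with itself. *)
have [||A [B [XE Ab Bb]]] := @gram_contraction_split _ _ _ (coord X) ((1 + e) ^+ 2)%:C%C.
- move=> T; rewrite /hs_sqnorm.
  rewrite -!(pair_bigA _ (fun i j => `|_ i j| ^+ 2)) /=.
  have := OH_dual_pairing X1 X1 (fun i j => T i j); congr (_ <= _).
  apply: eq_bigr => k _; apply: eq_bigr => i _; congr (`|_| ^+ 2).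
  rewrite !mxE exchange_big; apply: eq_bigr => l _; apply: eq_bigr => j _.
  by rewrite !mxE.
- by rewrite -[1]/(1%:C%C) ltcR expr_gt1 ?ltrDl // addr_ge0 // ltW.
exists A, B; split=> //; rewrite expr_div_n.
- by rewrite rmorphM fmorphV /= -natrX rmorph_nat.
- by rewrite rmorphM fmorphV /= -natrX rmorph_nat.
Qed.

End OHSplit.

(** * Complete contractivity of the two inclusions *)

Section Inclusions.
Variables (R : realType) (OH : OHspace R).

Lemma cap_to_OH_contractive : completely_contractive (cap_to_OH OH).
Proof.
apply: ub_ereal_sup => _ [n [W W1 ->]].
set X := map_mx (cap_to_OH OH) W.
pose x : 'M[ell2 R]_n := map_mx (fun w : capCR R => (val w).1) W.
have [xC xR] : col_bounded 1 x /\ col_bounded 1 x^T.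
  move: W1; rewrite /= ge_max => /andP[W1 W2]; split.
    have := W1; rewrite -[map_mx fst _]map_mx_comp colH_leP // expr1n.
    exact.
  (* On the diagonal the two components agree, so the row bound concerns the same matrix [x]. *)
  have -> : x = map_mx (fun w : capCR R => (val w).2) W.
    by apply/matrixP => i j; rewrite !mxE; apply/eqP; exact: valP (W i j).
  have := W2; rewrite -[map_mx snd _]map_mx_comp rowH_leP // expr1n.
  exact.
(* By self-duality the norm of [X] is the supremum of its pairings with matrices [Y] in the unit
   ball over OH. *)
rewrite -(oh_selfdual X); apply: ub_ereal_sup => _ [m [Y Y1 ->]].
apply/lee_addgt0Pr => e e0; have e1 : 0 <= 1 + e by rewrite addr_ge0 // ltW.
rewrite -EFinD mxB_leP // => v.
have [A [B [YE Ab Bb]]] := OH_split Y1 e0.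
set r := ((1 + e) / 2 : R) in Ab Bb.
have r0 : 0 <= (r ^+ 2)%:C%C :> R[i] by rewrite ler0c exprn_ge0 // divr_ge0.
(* The column part [A] meets the row bound of [x], and the row part [B] its column bound; each
   contributes (1 + e) / 2. *)
have hA := pairing_le v r0 ler01 Ab xR.
have hB := pairing_le_tr v r0 ler01 Bb xC.
rewrite mulr1 in hA; rewrite mulr1 in hB.
have -> : 1 + e = 2 * r by rewrite mulrC divfK.
apply: le_trans (sum_split_le hA hB).
rewrite le_eqVlt; apply/orP; left; apply/eqP.
apply: eq_bigr => k _; apply: eq_bigr => i _; congr (`|_| ^+ 2).
rewrite -big_split; apply: eq_bigr => l _.
rewrite -big_split; apply: eq_bigr => j _ /=.
have /matrixP/(_ k l) := YE; rewrite !mxE /= => ->.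
by rewrite /cap_to_OH oh_ofK dotpDl mulrDl.
Qed.

Lemma OH_to_sum_contractive : completely_contractive (OH_to_sum OH).
Proof.
apply: ub_ereal_sup => _ [n [X X1 ->]].
apply/lee_addgt0Pr => e e0; rewrite -EFinD.
have [A [B [XE Ab Bb]]] := OH_split X1 e0.
set r := ((1 + e) / 2 : R) in Ab Bb.
have r0 : 0 < r by rewrite divr_gt0 // addr_gt0.
have -> : 1 + e = 2 * r by rewrite mulrC divfK.
pose Y : 'M[sum_one (colH R) (rowH R)]_n := \matrix_(i, j) (A i j, B i j).
(* The difference (A, B) - (A + B, 0) = (-B, B) is antidiagonal, so [Y] lifts the image of [X]. *)
have YX : map_mx (quot_proj (@antidiag_pred R)) Y = map_mx (OH_to_sum OH) X.
  apply/matrixP => i j; rewrite !mxE; apply/quot_projP/eqP => /=.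
  have /matrixP/(_ i j) := XE; rewrite !mxE => ->.
  by rewrite subr0 opprB addrAC subrr add0r.
apply: (@le_trans _ _ (mn_norm (sum_one (colH R) (rowH R)) Y)).
  by apply: ereal_inf_lbound; exists Y.
have YA : map_mx fst Y = A by apply/matrixP => i j; rewrite !mxE.
have YB : map_mx snd Y = B by apply/matrixP => i j; rewrite !mxE.
apply: sum_one_le => //.
  rewrite YA colH_leP // expr1n; exact: col_bounded_scale.
rewrite YB rowH_leP // expr1n map_trmx; exact: col_bounded_scale.
Qed.

End Inclusions.

Theorem mainTheorem14 (R : realType) (OH : OHspace R) :
  completely_contractive (cap_to_OH OH) /\
  completely_contractive (OH_to_sum OH).
Proof. by split; [exact: cap_to_OH_contractive | exact: OH_to_sum_contractive]. Qed.
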